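(* Let $\mathcal M(\mathcal T)$ be a decomposable CSmodel (i.e. $\mathcal T$ is a balanced CStree), and let $\mathcal C$ be a collection of contexts with associated DAGs $G_{X_C=\mathbf x_C}$, $(X_C=\mathbf x_C)\in\mathcal C$, such that $\mathcal J(\mathcal T)=\bigcup_{(X_C=\mathbf x_C)\in\mathcal C}\mathrm{global}(G_{X_C=\mathbf x_C})$ (for example, the collection of minimal contexts of $\mathcal T$ with their minimal context DAGs). Then $\ker(\psi_{\mathcal T})$ is generated by the binomials associated to all saturated CSI statements that hold in the context DAGs $G_{X_C=\mathbf x_C}$, $(X_C=\mathbf x_C)\in\mathcal C$, i.e. $$\ker(\psi_{\mathcal T})=\sum_{(X_C=\mathbf x_C)\in\mathcal C}I_{\mathrm{Sat}(G_{X_C=\mathbf x_C})}.$$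
   Context: Notation. $[p]=\{1,\dots,p\}$; $X_1,\dots,X_p$ are discrete random variables, $X_i$ with state space $[d_i]=\{1,\dots,d_i\}$. For $A\subseteq[p]$ let $\mathcal R_A=\prod_{i\in A}[d_i]$, $\mathcal R=\mathcal R_{[p]}$. For $\mathbf x\in\mathcal R_B$ and $A\subseteq B$, $\mathbf x_A=(x_i)_{i\in A}$; for disjoint $A,B$, $\mathbf x_A\mathbf x_B\in\mathcal R_{A\cup B}$ is the combined outcome. $\mathbb R[D]=\mathbb R[p_{\mathbf x}:\mathbf x\in\mathcal R]$. CStrees. Let $\mathcal T=(V,E)$ be the rooted tree with $V=\{\mathrm{root}\}\cup\bigcup_{j\in[p]}\mathcal R_{[j]}$ and edges $\mathrm{root}\to x_1$ and $x_1\cdots x_{k-1}\to x_1\cdots x_k$. Its $k$-th level is $L_k=\mathcal R_{[k]}$ ($L_0=\{\mathrm{root}\}$); $E(v)$ is the set of outgoing edges of $v$. A labeling $\theta:E\to\mathcal L$ ($\mathcal L$ a finite set) makes $\mathcal T$ a staged tree if $|\theta(E(v))|=|E(v)|$ for all $v$, and $\theta(E(v)),\theta(E(w))$ are equal or disjoint for all $v,w$. Non-leaf vertices $v,w$ are in the same stage iff $\theta(E(v))=\theta(E(w))$; the equivalence classes are the stages (leaves are regarded as singleton stages). A staged tree is a CStree if: (1) $\theta(E(v))\ne\theta(E(w))$ for non-leaf $v,w$ in different levels; (2) $\theta(x_1\cdots x_{k-1}\to x_1\cdots x_{k-1}x_k)=\theta(y_1\cdots y_{k-1}\to y_1\cdots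 y_{k-1}x_k)$ whenever $x_1\cdots x_{k-1}$ and $y_1\cdots y_{k-1}$ are in the same stage; (3) for every $k\in[p]$ and every stage $S\subseteq L_{k-1}$ there are $C\subseteq[k-1]$ and $\mathbf x_C\in\mathcal R_C$ with $S=\{\mathbf x_C\mathbf y:\mathbf y\in\mathcal R_{[k-1]\setminus C}\}$. Balanced. For $v\in L_{k-1}$ let $t(v)=\sum_{\mathbf z\in\mathcal R_{[p]\setminus[k-1]}}\prod_{e\in E(v\to v\mathbf z)}\theta(e)$ in the polynomial ring $\mathbb R[\theta(e):e\in E]$ whose variables are the labels ($E(v\to v\mathbf z)$: edges on the path from $v$ to $v\mathbf z$). $\mathcal T$ is balanced if for every $k\in[p]$, all $v,w\in L_{k-1}$ in the same stage and all $s,r\in[d_k]$: $t(vs)t(wr)=t(vr)t(ws)$ in this ring. A decomposable CSmodel is the model $\mathcal M(\mathcal T)$ of a balanced CStree. The map $\psi_{\mathcal T}$. Let $\langle\theta-1\rangle=\langle\sum_{e\in E(v)}\theta(e)-1: v\in V\text{ non-leaf}\rangle$ and $\mathbb R[\Theta_{\mathcal T}]=\mathbb R[\theta(e):e\in E]/\langle\theta-1\rangle$. With a homogenizing variable $z$, $\psi_{\mathcal T}:\mathbb R[D]\to\mathbb R[\Theta_{\mathcal T}][z]$ is the ring homomorphism $p_{\mathbf x}\mapsto z\prod_{e\in E(\mathrm{root}\to\mathbf x)}\theta(e)$, where $E(\mathrm{root}\to\mathbf x)$ is the set of edges of the path from the root to the leaf $\mathbf x$. CSI statements and $\mathcal J(\mathcal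 T)$. A CSI statement is written $X_A\perp X_B\mid X_S,X_C=\mathbf x_C$ with $A,B,S,C\subseteq[p]$ pairwise disjoint and $\mathbf x_C\in\mathcal R_C$ (trivial if $A$ or $B$ is empty); if $C=\emptyset$ it is a CI statement. It is saturated if $A\cup B\cup S\cup C=[p]$. The polynomials associated to a saturated statement are $p_{\mathbf x_A\mathbf x_B\mathbf x_S\mathbf x_C}p_{\mathbf y_A\mathbf y_B\mathbf x_S\mathbf x_C}-p_{\mathbf x_A\mathbf y_B\mathbf x_S\mathbf x_C}p_{\mathbf y_A\mathbf x_B\mathbf x_S\mathbf x_C}$ for all $\mathbf x_A,\mathbf y_A\in\mathcal R_A$, $\mathbf x_B,\mathbf y_B\in\mathcal R_B$, $\mathbf x_S\in\mathcal R_S$. For a stage $S\subseteq L_{k-1}$ let $C\subseteq[k-1]$ be the set of indices at which all elements of $S$ agree and $\mathbf x_C$ the common value; the stage statement is $X_k\perp X_{[k-1]\setminus C}\mid X_C=\mathbf x_C$. $\mathcal J(\mathcal T)$ is the set of all CSI statements derivable from the stage statements by the CSI axioms (all index sets disjoint; $A\perp B|S,\mathbf x_C$ abbreviates $X_A\perp X_B|X_S,X_C=\mathbf x_C$): symmetry: $A\perp B|S,\mathbf x_C\Rightarrow B\perp A|S,\mathbf x_C$; decomposition: $A\perp B\cup D|S,\mathbf x_C\Rightarrow A\perp B|S,\mathbf x_C$; weak union: $A\perp B\cup D|S,\mathbf x_C\Rightarrow A\perp B|S\cup D,\mathbf x_C$; contraction: $A\perp B|S\cup D,\mathbf x_C$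 and $A\perp D|S,\mathbf x_C\Rightarrow A\perp B\cup D|S,\mathbf x_C$; intersection: $A\perp B|S\cup D,\mathbf x_C$ and $A\perp S|B\cup D,\mathbf x_C\Rightarrow A\perp B\cup S|D,\mathbf x_C$; specialization: $A\perp B|S,\mathbf x_C$, $T\subseteq S$, $\mathbf x_T\in\mathcal R_T\Rightarrow A\perp B|S\setminus T,\mathbf x_{T\cup C}$; absorption: if for some $T\subseteq C$ one has $A\perp B|S,\mathbf x_{C\setminus T}\mathbf x_T$ for all $\mathbf x_T\in\mathcal R_T$, then $A\perp B|S\cup T,\mathbf x_{C\setminus T}$. Context DAGs. A DAG $G_{X_C=\mathbf x_C}$ associated to a context $X_C=\mathbf x_C$ has vertex set $[p]\setminus C$ and all edges $i\to j$ with $i<j$. $\mathrm{global}(G_{X_C=\mathbf x_C})$ is the set of its d-separation statements $X_A\perp X_B|X_S$ ($A,B,S\subseteq[p]\setminus C$), each read as the CSI statement $X_A\perp X_B|X_S,X_C=\mathbf x_C$. The condition $\mathcal J(\mathcal T)=\bigcup_{\mathcal C}\mathrm{global}(G_{X_C=\mathbf x_C})$ means that the CSI statements that hold in $\mathcal T$ are the same as those that hold in the context DAGs, statements being identified up to specialization and absorption (i.e. $\mathcal J(\mathcal T)$ is the closure of the right-hand side under these two axioms). $\mathrm{Sat}(G_{X_C=\mathbf x_C})$ is the set of those statements of $\mathrm{global}(G_{X_C=\mathbf x_C})$ with $A\cup B\cup S=[p]\setminus C$ (so saturated as CSI statements in context $X_C=\mathbf x_C$), and $I_{\mathrm{Sat}(G_{X_C=\mathbf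 x_C})}\subseteq\mathbb R[D]$ is the ideal generated by the polynomials associated to them. Minimal contexts. $X_C=\mathbf x_C$ ($C$ possibly empty) is a minimal context of $\mathcal T$ if there is a statement $X_A\perp X_B|X_S,X_C=\mathbf x_C$ in $\mathcal J(\mathcal T)$ with $A,B\neq\emptyset$ such that for no nonempty $T\subseteq C$ is $X_A\perp X_B|X_{S\cup T},X_{C\setminus T}=\mathbf x_{C\setminus T}$ in $\mathcal J(\mathcal T)$. Its minimal context DAG $G_{X_C=\mathbf x_C}$ is the DAG on $[p]\setminus C$, edges $i\to j$ only with $i<j$, that is a minimal I-MAP of $\mathcal J(X_C=\mathbf x_C)=\{X_A\perp X_B|X_S:\ X_A\perp X_B|X_S,X_C=\mathbf x_C\in\mathcal J(\mathcal T)\}$: all its d-separation statements lie in this set, and this fails after removing any edge. *)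

(* Defs.v *)
From mathcomp Require Import all_boot all_order all_algebra.
From mathcomp Require Import reals mpoly.

Set Implicit Arguments.
Unset Strict Implicit.
Unset Printing Implicit Defensive.

Import GRing.Theory.
Local Open Scope ring_scope.

(* Indices are 0-based: the variable X_k of the text is [k-1 : 'I_p], its state
   space is ['I_(d (k-1))], and [k] is [prefix k].  Levels keep their numbers:
   L_k is the set of outcomes of the first k variables. *)

Section Outcomes.
Variables (p : nat) (d : 'I_p -> nat).

Definition outcome := {dffun forall i : 'I_p, 'I_(d i)}.

(* An element x_A of R_A, for an arbitrary A: [x i] is [Some] exactly when
   i \in A.  In particular one [pout] encodes both C and x_C of a context. *)
Definition pout := {dffun forall i : 'I_p, option 'I_(d i)}.

Definition dom (x : pout) : {set 'I_p} := [set i | x i != None].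

Definition outcomes (A : {set 'I_p}) : {set pout} := [set x | dom x == A].

Definition restr (A : {set 'I_p}) (x : pout) : pout :=
  [ffun i => if i \in A then x i else None].

(* The combined outcome x_A x_B; only used on disjoint domains. *)
Definition merge (x y : pout) : pout :=
  [ffun i => if x i is Some a then Some a else y i].

Definition full (x : outcome) : pout := [ffun i => Some (x i)].

Definition prefix (k : nat) : {set 'I_p} := [set i : 'I_p | (i < k)%N].

End Outcomes.

Arguments prefix {p} k.

Section CSI.
Variables (p : nat) (d : 'I_p -> nat).

(* [Z A B S x] : the statement X_A _||_ X_B | X_S, X_C = x_C belongs to the
   set Z, where C = dom x. *)
Definition csi_set :=
  {set 'I_p} -> {set 'I_p} -> {set 'I_p} -> pout d -> Prop.

Definition pwdisjoint (s : seq {set 'I_p}) : bool :=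
  pairwise (fun X Y : {set 'I_p} => [disjoint X & Y]) s.

Inductive csi_closure (Z : csi_set) : csi_set :=
| csi_base A B S x :
    Z A B S x -> csi_closure Z A B S x
| csi_symmetry A B S x :
    pwdisjoint [:: A; B; S; dom x] ->
    csi_closure Z A B S x -> csi_closure Z B A S x
| csi_decomposition A B D S x :
    pwdisjoint [:: A; B; D; S; dom x] ->
    csi_closure Z A (B :|: D) S x -> csi_closure Z A B S x
| csi_weak_union A B D S x :
    pwdisjoint [:: A; B; D; S; dom x] ->
    csi_closure Z A (B :|: D) S x -> csi_closure Z A B (S :|: D) x
| csi_contraction A B D S x :
    pwdisjoint [:: A; B; D; S; dom x] ->
    csi_closure Z A B (S :|: D) x -> csi_closure Z A D S x ->
    csi_closure Z A (B :|: D) S x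
| csi_intersection A B D S x :
    pwdisjoint [:: A; B; D; S; dom x] ->
    csi_closure Z A B (S :|: D) x -> csi_closure Z A S (B :|: D) x ->
    csi_closure Z A (B :|: S) D x
| csi_specialization A B S x t :
    pwdisjoint [:: A; B; S; dom x] -> dom t \subset S ->
    csi_closure Z A B S x -> csi_closure Z A B (S :\: dom t) (merge t x)
(* here x is x_{C \ T} *)
| csi_absorption A B S (T : {set 'I_p}) x :
    pwdisjoint [:: A; B; S; T; dom x] ->
    (forall t, t \in outcomes d T -> csi_closure Z A B S (merge t x)) ->
    csi_closure Z A B (S :|: T) x.

Inductive sa_closure (Z : csi_set) : csi_set :=
| sa_base A B S x :
    Z A B S x -> sa_closure Z A B S x
| sa_specialization A B S x t :
    pwdisjoint [:: A; B; S; dom x] -> dom t \subset S ->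
    sa_closure Z A B S x -> sa_closure Z A B (S :\: dom t) (merge t x)
| sa_absorption A B S (T : {set 'I_p}) x :
    pwdisjoint [:: A; B; S; T; dom x] ->
    (forall t, t \in outcomes d T -> sa_closure Z A B S (merge t x)) ->
    sa_closure Z A B (S :|: T) x.

(* Statements with A or B empty hold vacuously and are not compared. *)
Definition csi_equiv (Z1 Z2 : csi_set) : Prop :=
  forall A B S x, A != set0 -> B != set0 -> (Z1 A B S x <-> Z2 A B S x).

End CSI.

Section DAG.
Variables (p : nat) (d : 'I_p -> nat).

Definition context_dag (c : pout d) (G : rel 'I_p) : Prop :=
  forall i j, G i j -> [/\ (i < j)%N, i \notin dom c & j \notin dom c].

Definition skeleton (G : rel 'I_p) : rel 'I_p := fun i j => G i j || G j i.

(* No inner vertex of the path s is blocking, given S: colliders have a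
   descendant (possibly themselves) in S, and non-colliders are outside S. *)
Fixpoint active (G : rel 'I_p) (S : {set 'I_p}) (s : seq 'I_p) : bool :=
  match s with
  | u :: ((v :: w :: _) as s') =>
      (if G u v && G w v then [exists t in S, connect G v t] else v \notin S)
      && active G S s'
  | _ => true
  end.

Definition d_separated (G : rel 'I_p) (A B S : {set 'I_p}) : Prop :=
  forall a q, a \in A -> last a q \in B ->
    path (skeleton G) a q -> uniq (a :: q) -> ~~ active G S (a :: q).

Definition in_global (c : pout d) (G : rel 'I_p) (A B S : {set 'I_p}) : Prop :=
  pwdisjoint [:: A; B; S; dom c] /\ d_separated G A B S.

Definition global_union (CC : {set pout d}) (G : pout d -> rel 'I_p) :
    csi_set d :=
  fun A B S x => x \in CC /\ in_global x (G x) A B S.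

End DAG.

Section Tree.
Variables (p : nat) (d : 'I_p -> nat) (L : finType).
(* [theta v w] is the label of the edge v -> w; values off the edges of the
   tree are never used. *)
Variable theta : pout d -> pout d -> L.

Definition level (k : nat) : {set pout d} := outcomes d (prefix k).

Definition root : pout d := [ffun _ => None].

Definition vertex (v : pout d) : bool := [exists k : 'I_p.+1, v \in level k].

Definition nonleaf (v : pout d) : bool := [exists k : 'I_p, v \in level k].

Definition children (v : pout d) : {set pout d} :=
  [set w | [exists k : 'I_p,
     [&& v \in level k, w \in level k.+1 & restr (prefix k) w == v]]].

Definition edge_labels (v : pout d) : {set L} := [set theta v w | w in children v].

Definition staged_tree : Prop :=
  (forall v, vertex v -> #|edge_labels v| = #|children v|) /\
  (forall v w, vertex v -> vertex w ->
     edge_labels v = edge_labels w \/ [disjoint edge_labels v & edge_labels w]).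

Definition same_stage (v w : pout d) : bool := edge_labels v == edge_labels w.

Definition stage (v : pout d) : {set pout d} :=
  [set w | nonleaf w && same_stage v w].

Definition CStree : Prop :=
  [/\ staged_tree,
      forall (j k : 'I_p) v w, j != k -> v \in level j -> w \in level k ->
        edge_labels v != edge_labels w,
      forall (k : 'I_p) v w, v \in level k -> w \in level k -> same_stage v w ->
        forall v' w', v' \in children v -> w' \in children w -> v' k = w' k ->
          theta v v' = theta w w'
    & forall (k : 'I_p) v, v \in level k ->
        exists2 x : pout d, dom x \subset prefix k
          & stage v = [set merge x y | y in outcomes d (prefix k :\: dom x)]].

(* For the stage of v \in level k: the indices where all its elements agree *)
Definition stage_context (k : 'I_p) (v : pout d) : {set 'I_p} :=
  [set i in prefix k | [forall w in stage v, w i == v i]].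

Inductive stage_statement : csi_set d :=
| StageStatement (k : 'I_p) (v : pout d) : v \in level k ->
    stage_statement [set k] (prefix k :\: stage_context k v) set0
      (restr (stage_context k v) v).

Definition J_tree : csi_set d := csi_closure stage_statement.

Variable R : realType.

(* The polynomial ring R[theta(e) : e \in E], with one variable per element of
   L.  Labels not used by the tree only add free variables, which affect neither
   balancedness nor ker psi. *)
Definition label_ring := {mpoly R[#|L|]}.

Definition label_var (l : L) : label_ring := 'X_(enum_rank l).

(* The product of the labels on the path from the vertex v to the leaf x *)
Definition path_monomial (v x : pout d) : label_ring :=
  \prod_(j : 'I_p | j \notin dom v)
     label_var (theta (restr (prefix j) x) (restr (prefix j.+1) x)).

Definition t_poly (v : pout d) : label_ring :=
  \sum_(z in outcomes d (~: dom v)) path_monomial v (merge v z).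

Definition balanced : Prop :=
  forall (k : 'I_p) v w, v \in level k -> w \in level k -> same_stage v w ->
  forall vs vr ws wr,
    vs \in children v -> vr \in children v ->
    ws \in children w -> wr \in children w ->
    vs k = ws k -> vr k = wr k ->
    t_poly vs * t_poly wr = t_poly vr * t_poly ws.

End Tree.

Arguments balanced {p d L} theta R.

Section Ideals.

Definition ideal_gen (K : comNzRingType) (Z : K -> Prop) (f : K) : Prop :=
  exists n (a g : 'I_n -> K),
    (forall i, Z (g i)) /\ f = \sum_(i < n) a i * g i.

Definition ideal_sum (K : comNzRingType) (I : finType) (C : {set I})
    (Id : I -> K -> Prop) (f : K) : Prop :=
  exists g : I -> K, (forall c, c \in C -> Id c (g c)) /\ f = \sum_(c in C) g c.

End Ideals.

Section Model.
Variables (R : realType) (p : nat) (d : 'I_p -> nat) (L : finType).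
Variable theta : pout d -> pout d -> L.

Definition model_ring := {mpoly R[#|{: outcome d}|]}.

Definition p_ (x : outcome d) : model_ring := 'X_(enum_rank x).

Definition theta_relation (f : label_ring L R) : Prop :=
  exists2 v, nonleaf v & f = \sum_(w in children v) label_var R (theta v w) - 1.

(* psi before passing to the quotient: the R-algebra morphism into
   R[theta(e) : e \in E][z] sending p_x to z times the path monomial of x. *)
Definition psi_lift (f : model_ring) : {poly label_ring L R} :=
  mmap (fun c : R => (c%:MP)%:P)
       (fun i => (path_monomial theta R (root d) (full (enum_val i)))%:P * 'X) f.

(* psi f = 0 in (R[theta(e)] / <theta - 1>)[z]: each coefficient in z of the
   lift lies in <theta - 1>. *)
Definition ker_psi (f : model_ring) : Prop :=
  forall i : nat, ideal_gen theta_relation (psi_lift f)`_i.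

(* [swap A x y] is y_A together with the other coordinates of x. *)
Definition swap (A : {set 'I_p}) (x y : outcome d) : outcome d :=
  [ffun i => if i \in A then y i else x i].

(* The polynomials of a saturated statement: x = x_A x_B x_S x_C and
   y = y_A y_B x_S x_C. *)
Inductive csi_binomial (A B S : {set 'I_p}) (c : pout d) : model_ring -> Prop :=
| CSIBinomial (x y : outcome d) :
    restr (dom c) (full x) = c -> restr (dom c) (full y) = c ->
    restr S (full x) = restr S (full y) ->
    csi_binomial A B S c (p_ x * p_ y - p_ (swap B x y) * p_ (swap A x y)).

Definition I_Sat (c : pout d) (G : rel 'I_p) : model_ring -> Prop :=
  ideal_gen (fun f => exists A B S,
    [/\ in_global c G A B S, A :|: B :|: S = ~: dom c & csi_binomial A B S c f]).

End Model.

(* Main.v *)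
From Pilot Require Import Defs.
From mathcomp Require Import all_boot all_order all_algebra.
From mathcomp Require Import reals mpoly.
From mathcomp Require Import ring lra zify.

(** Give the outcome x the weight P(x) = product of q(l) over the labels l on the
    path to x, for an arbitrary q > 0 that need not satisfy the sum-to-one
    conditions.  Balancedness says exactly that P satisfies the stage statements,
    and the CSI axioms preserve truth for positive P, so every saturated
    statement of J(T) gives a binomial that already vanishes before dividing by
    <theta - 1>.

    Conversely, q can be replaced by the transition probabilities of P, which are
    normalized and, by balancedness, constant along labels.  Hence an element of
    ker psi vanishes at all q > 0, and ker psi is spanned by the differences of
    monomials with equal label content.  Such monomials are connected level by
    level by exchanging k-th coordinates within a stage.  Each exchange is a move
    of a saturated statement: a statement A _||_ B | x_C with A, B, C covering
    the first k variables lifts to k + 1 variables, because counting the vertices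
    of one stage forces the stages of level k to depend on x_A only or on x_B
    only, and contraction applies. *)

Set Implicit Arguments.
Unset Strict Implicit.
Unset Printing Implicit Defensive.

Import Order.TTheory GRing.Theory Num.Theory.
(* Again, since [merge] of [path] hides the one of [Defs]. *)
Import Pilot.Defs.
Local Open Scope ring_scope.

(** * Outcomes and marginals *)

Section Agreement.
Variables (p : nat) (d : 'I_p -> nat).
Implicit Types (A B C D E S : {set 'I_p}) (x y z : outcome d) (c t u : pout d).

Definition agree D x y := [forall i in D, x i == y i].

Lemma agreeP D x y : reflect (forall i, i \in D -> x i = y i) (agree D x y).
Proof.
by apply: (iffP forall_inP) => h i iD; [exact/eqP/h | exact/eqP/h].
Qed.

Lemma agree_refl D x : agree D x x.
Proof. exact/agreeP. Qed.

Lemma agree_sym D x y : agree D x y = agree D y x.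
Proof. by apply: eq_forallb => i; rewrite eq_sym. Qed.

Lemma agree_trans D y x z : agree D x y -> agree D y z -> agree D x z.
Proof. by move=> /agreeP xy /agreeP yz; apply/agreeP => i iD; rewrite xy ?yz. Qed.

Lemma agree_sub D E x y : D \subset E -> agree E x y -> agree D x y.
Proof. by move=> /subsetP sDE /agreeP h; apply/agreeP => i /sDE; apply: h. Qed.

Lemma agree_eql D x y z : agree D x y -> agree D x z = agree D y z.
Proof.
move=> xy; apply/idP/idP; first by apply: agree_trans; rewrite agree_sym.
exact: agree_trans.
Qed.

Lemma agreeT x y : agree setT x y = (x == y).
Proof.
apply/agreeP/eqP => [h|-> //]; by apply/ffunP => i; apply: h; rewrite inE.
Qed.

Lemma agree0 x y : agree set0 x y.
Proof. by apply/agreeP => i; rewrite inE. Qed.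

Lemma agreeU D E x y : agree (D :|: E) x y = agree D x y && agree E x y.
Proof.
apply/agreeP/andP => [h|[/agreeP hD /agreeP hE] i].
  by split; apply/agreeP => i iD; apply: h; rewrite inE iD ?orbT.
by rewrite inE => /orP[/hD|/hE].
Qed.

Lemma swapE D x y i : swap D x y i = if i \in D then y i else x i.
Proof. by rewrite ffunE. Qed.

Lemma agree_swap_in D E x y : D \subset E -> agree D (swap E x y) y.
Proof. by move=> /subsetP s; apply/agreeP => i iD; rewrite swapE s. Qed.

Lemma agree_swap_out D E x y : [disjoint D & E] -> agree D (swap E x y) x.
Proof.
move=> dDE; apply/agreeP => i iD; rewrite swapE.
by rewrite (disjointFr dDE iD).
Qed.

Definition compat c z := restr (dom c) (full z) == c.

Lemma compatP c z :
  reflect (forall i, i \in dom c -> c i = Some (z i)) (compat c z).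
Proof.
apply: (iffP eqP) => [h i iD|h]; first by rewrite -[in LHS]h !ffunE iD.
apply/ffunP => i; rewrite !ffunE; case: ifPn => [/h -> //|].
by rewrite inE negbK => /eqP ->.
Qed.

Lemma dom_restr_full D z : dom (restr D (full z)) = D.
Proof. by apply/setP => i; rewrite inE !ffunE; case: ifP. Qed.

Lemma dom_merge t c : dom (merge t c) = dom t :|: dom c.
Proof. by apply/setP => i; rewrite !inE !ffunE; case: (t i). Qed.

Lemma restr_eq_agree D y z :
  (restr D (full y) == restr D (full z)) = agree D y z.
Proof.
apply/eqP/agreeP => [/ffunP h i iD|h].
  by have := h i; rewrite !ffunE iD => -[].
by apply/ffunP => i; rewrite !ffunE; case: ifP => // /h ->.
Qed.

Lemma compat_agree c y z : compat c z -> compat c y = agree (dom c) y z.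
Proof. by move=> /eqP cz; rewrite /compat -restr_eq_agree cz. Qed.

Lemma compat_restr D y z : compat (restr D (full z)) y = agree D y z.
Proof. by rewrite /compat dom_restr_full restr_eq_agree. Qed.

Lemma compat_merge t c z : [disjoint dom t & dom c] ->
  compat (merge t c) z = compat t z && compat c z.
Proof.
move=> dtc; apply/compatP/andP => [h|[/compatP ht /compatP hc] i].
  split; apply/compatP => i iD; have := h i; rewrite dom_merge inE iD ?orbT !ffunE => /(_ isT).
    by move: iD; rewrite inE; case: (t i).
  by move: (disjointFl dtc iD); rewrite inE; case: (t i).
rewrite dom_merge inE !ffunE; case: (boolP (i \in dom t)) => [it _|].
  by rewrite (ht i it).
by rewrite inE negbK => /eqP -> /= /hc.
Qed.

Hypothesis d_gt0 : forall i, (0 < d i)%N.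

Lemma compat_exists c : exists z, compat c z.
Proof.
exists [ffun i => odflt (Ordinal (d_gt0 i)) (c i)]; apply/compatP => i.
by rewrite inE ffunE; case: (c i).
Qed.

End Agreement.

Section Marginals.
Variables (R : realFieldType) (p : nat) (d : 'I_p -> nat).
Implicit Types (A B C D E S : {set 'I_p}) (x y z w : outcome d) (c t u : pout d).

(** Marginals are indexed by full outcomes of which only the coordinates in [D] matter, so [agree]
    replaces equality of partial outcomes. *)
Definition marginal (P : outcome d -> R) D z := \sum_(y | agree D y z) P y.

Definition cylinder D z := [pred y : outcome d | agree D y z].

(** Overwriting the [D]-coordinates carries one cylinder bijectively onto the other. *)
Lemma card_cylinder D y z : #|cylinder D y| = #|cylinder D z|.
Proof.
rewrite -!sum1_card (reindex_onto (fun w => swap D w y) (fun w => swap D w z)) /=.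
  apply: eq_bigl => w; rewrite !inE agree_swap_in // /=.
  apply/eqP/agreeP => [h i iD|h]; first by rewrite -h !swapE iD.
  by apply/ffunP => i; rewrite !swapE; case: ifP => [/h ->|->].
move=> w; rewrite inE => /agreeP h; apply/ffunP => i.
by rewrite !swapE; case: ifP => [/h ->|->].
Qed.

Lemma cylinder_gt0 D z : 0 < #|cylinder D z|%:R :> R.
Proof. by rewrite ltr0n; apply/card_gt0P; exists z; rewrite inE agree_refl. Qed.

Lemma marginal_agree P D y z : agree D y z -> marginal P D y = marginal P D z.
Proof.
by move=> yz; apply: eq_bigl => w; rewrite agree_sym (agree_eql _ yz) agree_sym.
Qed.

Lemma marginalT P z : marginal P setT z = P z.
Proof. by rewrite /marginal (big_pred1 z) // => y; rewrite agreeT. Qed.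

Lemma marginal_gt0 P D z : (forall y, 0 < P y) -> 0 < marginal P D z.
Proof.
move=> P_gt0; rewrite /marginal (bigD1 z) ?agree_refl //=.
by rewrite ltr_wpDr //; apply: sumr_ge0 => y _; apply: ltW.
Qed.

(* Exchanging the sums, each outcome in the (E :&: D)-cylinder of z is counted
   once for every point of a (D :|: E)-cylinder. *)
Lemma sum_marginal P D E z :
  \sum_(y | agree E y z) marginal P D y =
  #|cylinder (D :|: E) z|%:R * marginal P (E :&: D) z.
Proof.
rewrite /marginal (exchange_big_dep (fun y => agree (E :&: D) y z)) /=; last first.
  move=> y w yz wy; apply: agree_trans (agree_sub (subsetIl _ _) yz).
  exact: agree_sub (subsetIr _ _) wy.
rewrite mulr_sumr; apply: eq_bigr => y yz.
rewrite sumr_const -[LHS]mulr_natl; congr (_%:R * _).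
rewrite (card_cylinder _ z (swap D z y)); apply: eq_card => w.
rewrite !inE agreeU unfold_in andbC (agree_sym D y).
apply/andP/andP => -[/agreeP wy /agreeP wz]; split; apply/agreeP => i iD.
- by rewrite swapE iD wy.
- rewrite swapE wz //; case: ifP => // iD'.
  by rewrite (agreeP _ _ _ yz) // inE iD.
- by rewrite wy // swapE iD.
rewrite wz // swapE; case: ifP => // iD'.
by rewrite (agreeP _ _ _ yz) // inE iD.
Qed.

End Marginals.

(** * Soundness of the CSI axioms *)

Lemma disjoint_in (T : finType) (A B : {set T}) i :
  [disjoint A & B] -> ~~ ((i \in A) && (i \in B)).
Proof. by move=> dAB; apply/andP => -[iA]; rewrite (disjointFr dAB iA). Qed.

Lemma subset_in (T : finType) (A B : {set T}) i :
  A \subset B -> (i \in A) ==> (i \in B).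
Proof. by move=> /subsetP sAB; apply/implyP/sAB. Qed.

Ltac split_pwdisjoint :=
  repeat match goal with
  | H : is_true (pwdisjoint _) |- _ => move: H; rewrite /pwdisjoint /= ?andbT
  | |- is_true (_ && _) -> _ => case/andP
  | |- is_true [disjoint _ & _] -> _ => let h := fresh "dis" in move=> h
  | |- is_true true -> _ => move=> _
  end.

(** Tests membership of a generic point and splits on all memberships. Domains, prefixes and
    singletons are generalized first, so that [inE] treats them as atoms. *)
Ltac set_decide :=
  split_pwdisjoint;
  repeat match goal with
  | H : context [dom ?x] |- _ => generalize dependent (dom x); intros
  | |- context [dom ?x] => generalize dependent (dom x); intros
  | H : context [@prefix ?p ?k] |- _ => generalize dependent (@prefix p k); intros
  | |- context [@prefix ?p ?k] => generalize dependent (@prefix p k); intros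
  | H : context [[set ?k]] |- _ => generalize dependent [set k]; intros
  | |- context [[set ?k]] => generalize dependent [set k]; intros
  end;
  first [ apply/setP => ? | apply/subsetP => ? | rewrite disjoints_subset; apply/subsetP => ? ];
  repeat match goal with
  | H : is_true [disjoint _ & _] |- context [?i \in _] =>
      move: (disjoint_in i H); clear H
  | H : is_true (_ \subset _) |- context [?i \in _] =>
      move: (subset_in i H); clear H
  | H : _ = _ :> {set _} |- context [?i \in _] =>
      move: (congr1 (fun X : {set _} => i \in X) H); clear H
  end;
  rewrite /= ?inE;
  repeat match goal with |- context [?i \in ?A] => case: (i \in A) end;
  by [].

Ltac pwdisjoint_decide :=
  rewrite /pwdisjoint /= ?andbT; do ?(apply/andP; split); set_decide.

Lemma setDUK (T : finType) (A B : {set T}) : A \subset B -> B :\: A :|: A = B.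
Proof. by move=> sAB; set_decide. Qed.

Section Soundness.
Variables (R : realFieldType) (p : nat) (d : 'I_p -> nat).
Implicit Types (A B C D E S T U : {set 'I_p}) (x y z w : outcome d).

Variable P : outcome d -> R.
Hypothesis P_gt0 : forall x, 0 < P x.

Local Notation M := (marginal P).

(** Cross-multiplied form of P(A,B|U) = P(A|U) P(B|U) at the values of [z]; it makes sense for an
    unnormalized [P]. *)
Definition cond_indep A B U z :=
  M (A :|: B :|: U) z * M U z = M (A :|: U) z * M (B :|: U) z.

Local Notation ci := cond_indep.

Lemma M_neq0 D z : M D z != 0.
Proof. by rewrite gt_eqF ?marginal_gt0. Qed.

(** Sum the hypothesis over the coordinates outside [A], [B] and [U]. This changes the
    [D]-coordinates, so the hypothesis is taken at all [y] agreeing with [z] on [U]. The sum runs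
    over full outcomes, whence the cylinder size as a common factor. *)
Lemma cond_indep_decomposition A B D U z :
  pwdisjoint [:: A; B; D; U] ->
  (forall y, agree U y z -> ci A (B :|: D) U y) -> ci A B U z.
Proof.
move=> dis h; rewrite /ci.
have N_neq0 : #|cylinder (A :|: (B :|: D) :|: U) z|%:R != 0 :> R.
  by rewrite gt_eqF ?cylinder_gt0.
apply: (mulfI N_neq0).
have := sum_marginal P (A :|: (B :|: D) :|: U) (A :|: B :|: U) z.
have -> : A :|: (B :|: D) :|: U :|: (A :|: B :|: U) = A :|: (B :|: D) :|: U.
  by set_decide.
have -> : (A :|: B :|: U) :&: (A :|: (B :|: D) :|: U) = A :|: B :|: U.
  by set_decide.
rewrite mulrA => <-.
have := sum_marginal P (B :|: D :|: U) (A :|: B :|: U) z.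
have -> : B :|: D :|: U :|: (A :|: B :|: U) = A :|: (B :|: D) :|: U by set_decide.
have -> : (A :|: B :|: U) :&: (B :|: D :|: U) = B :|: U by set_decide.
rewrite mulrCA => <-; rewrite mulr_suml mulr_sumr.
apply: eq_bigr => y yz.
have yU : agree U y z by apply: agree_sub yz; set_decide.
rewrite -(marginal_agree P yU) h //; congr (_ * _); apply: marginal_agree.
by apply: agree_sub yz; set_decide.
Qed.

Lemma cond_indep_sym A B U z : ci A B U z -> ci B A U z.
Proof. by rewrite /ci (setUC B A) => ->; rewrite mulrC. Qed.

(** The conclusion is the quotient of the hypothesis by the independence of [A] and [D] given [U],
    which decomposition supplies. *)
Lemma cond_indep_weak_union A B D U z :
  pwdisjoint [:: A; B; D; U] ->
  (forall y, agree U y z -> ci A (B :|: D) U y) -> ci A B (U :|: D) z.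
Proof.
move=> dis h.
have hD : ci A D U z.
  apply: (@cond_indep_decomposition A D B) => [|y yz].
    by pwdisjoint_decide.
  by rewrite setUC; apply: h.
have hBD := h z (agree_refl _ _).
apply: (mulfI (M_neq0 U z)); move: hD hBD; rewrite /ci.
have -> : A :|: B :|: (U :|: D) = A :|: (B :|: D) :|: U by set_decide.
have -> : A :|: D :|: U = A :|: (U :|: D) by set_decide.
have -> : B :|: (U :|: D) = B :|: D :|: U by set_decide.
have -> : U :|: D = D :|: U by set_decide.
by move=> h1 h2; rewrite mulrA (mulrC (M U z)) h2 mulrAC -h1; ring.
Qed.

Lemma cond_indep_contraction A B D U z :
  ci A B (U :|: D) z -> ci A D U z -> ci A (B :|: D) U z.
Proof.
move=> h1 h2; apply: (mulfI (M_neq0 (U :|: D) z)); move: h1 h2; rewrite /ci.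
have -> : A :|: B :|: (U :|: D) = A :|: (B :|: D) :|: U by set_decide.
have -> : A :|: D :|: U = A :|: (U :|: D) by set_decide.
have -> : B :|: (U :|: D) = B :|: D :|: U by set_decide.
have -> : D :|: U = U :|: D by set_decide.
move=> h1 h2; rewrite mulrA (mulrC (M (U :|: D) z)) h1 mulrAC h2; ring.
Qed.

(** Positivity permits cancelling the marginal of B, S, U, so the hypotheses give P(A|S,U) =
    P(A|B,U), which is [key]. Summing over S yields independence of A and B given U, and contraction
    finishes. *)
Lemma cond_indep_intersection A B S U z :
  pwdisjoint [:: A; B; S; U] ->
  (forall y, agree U y z -> ci A B (S :|: U) y) ->
  (forall y, agree U y z -> ci A S (B :|: U) y) -> ci A (B :|: S) U z.
Proof.
move=> dis h1 h2.
suff hB : ci A B U z.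
  rewrite setUC; apply: cond_indep_contraction => //.
  by rewrite (setUC U); apply: h2; apply: agree_refl.
have key y : agree U y z ->
    M (A :|: (S :|: U)) y * M (B :|: U) y = M (A :|: (B :|: U)) y * M (S :|: U) y.
  move=> yz; move: (h1 y yz) (h2 y yz); rewrite /ci.
  have -> : A :|: S :|: (B :|: U) = A :|: B :|: (S :|: U) by set_decide.
  have -> : S :|: (B :|: U) = B :|: (S :|: U) by set_decide.
  move=> e1 e2; apply: (mulIf (M_neq0 (B :|: (S :|: U)) y)).
  by rewrite mulrAC -e1 (mulrAC (M (A :|: (B :|: U)) y)) -e2; ring.
have N_neq0 : #|cylinder (A :|: B :|: S :|: U) z|%:R != 0 :> R.
  by rewrite gt_eqF ?cylinder_gt0.
have e1 := sum_marginal P (A :|: (S :|: U)) (A :|: B :|: U) z.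
have e2 := sum_marginal P (S :|: U) (A :|: B :|: U) z.
move: e1 e2.
have -> : A :|: (S :|: U) :|: (A :|: B :|: U) = A :|: B :|: S :|: U by set_decide.
have -> : (A :|: B :|: U) :&: (A :|: (S :|: U)) = A :|: U by set_decide.
have -> : S :|: U :|: (A :|: B :|: U) = A :|: B :|: S :|: U by set_decide.
have -> : (A :|: B :|: U) :&: (S :|: U) = U by set_decide.
move=> e1 e2; rewrite /ci; apply: (mulfI N_neq0).
rewrite mulrCA -e2 mulrA -e1 mulr_sumr mulr_suml; apply: eq_bigr => y yz.
have ag (X : {set 'I_p}) : X \subset A :|: B :|: U -> M X y = M X z.
  by move=> sX; apply: marginal_agree; apply: agree_sub yz.
rewrite -(ag (B :|: U)); last by set_decide.
rewrite key; last by apply: agree_sub yz; set_decide.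
rewrite -(ag (A :|: B :|: U)); last by set_decide.
by rewrite setUA.
Qed.

Definition csi_holds A B S (x : pout d) :=
  forall z, compat x z -> ci A B (S :|: dom x) z.

Lemma csi_closure_sound (Z : csi_set d) :
  (forall A B S (x : pout d), Z A B S x -> csi_holds A B S x) ->
  forall A B S (x : pout d), csi_closure Z A B S x -> csi_holds A B S x.
Proof.
move=> ZP A B S x; elim=> {A B S x}.
- by move=> A B S x /ZP.
- by move=> A B S x dis _ h z xz; apply/cond_indep_sym/h.
- move=> A B D S x dis _ h z xz; apply: (@cond_indep_decomposition A B D).
    by pwdisjoint_decide.
  move=> y yz; apply: h; rewrite (compat_agree _ xz).
  by apply: agree_sub yz; set_decide.
- move=> A B D S x dis _ h z xz; rewrite setUAC.
  apply: cond_indep_weak_union.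
    by pwdisjoint_decide.
  move=> y yz; apply: h; rewrite (compat_agree _ xz).
  by apply: agree_sub yz; set_decide.
- move=> A B D S x dis _ h1 _ h2 z xz; apply: cond_indep_contraction; last exact: h2.
  by rewrite setUAC; apply: h1.
- move=> A B D S x dis _ h1 _ h2 z xz; apply: cond_indep_intersection.
  + by pwdisjoint_decide.
  + move=> y yz; rewrite setUA; apply: h1; rewrite (compat_agree _ xz).
    by apply: agree_sub yz; set_decide.
  + move=> y yz; rewrite setUA; apply: h2; rewrite (compat_agree _ xz).
    by apply: agree_sub yz; set_decide.
- move=> A B S x t dis tS _ h z; rewrite compat_merge; last by set_decide.
  case/andP => _ xz; rewrite dom_merge.
  have -> : S :\: dom t :|: (dom t :|: dom x) = S :|: dom x by set_decide.
  exact: h.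
- move=> A B S T x dis _ h z xz.
  have disT : [disjoint T & dom x] by set_decide.
  pose t := restr T (full z).
  have dt : dom t = T by rewrite dom_restr_full.
  have -> : S :|: T :|: dom x = S :|: dom (merge t x) by rewrite dom_merge dt setUA.
  apply: h; first by rewrite inE dt.
  have dis_t : [disjoint dom t & dom x] by rewrite dt.
  by rewrite compat_merge // xz compat_restr agree_refl.
Qed.

(** Multiply the independence identities at [y] and [z], and those at the two swaps: the right-hand
    sides consist of the same four marginals. The square of [M U z] cancels. *)
Lemma csi_holds_swap A B S (c : pout d) y z :
  pwdisjoint [:: A; B; S; dom c] -> csi_holds A B S c ->
  compat c y -> compat c z -> agree S y z ->
  M (A :|: B :|: (S :|: dom c)) y * M (A :|: B :|: (S :|: dom c)) z =
  M (A :|: B :|: (S :|: dom c)) (swap B y z) *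
  M (A :|: B :|: (S :|: dom c)) (swap A y z).
Proof.
move=> dis h cy cz Syz; set U := S :|: dom c.
have Uyz : agree U y z by rewrite agreeU Syz -(compat_agree _ cz).
have swapU D (X : {set 'I_p}) : [disjoint X & D] -> M X (swap D y z) = M X y.
  by move=> dDX; apply/marginal_agree/agree_swap_out.
have swapD D : [disjoint D & U] -> M (D :|: U) (swap D y z) = M (D :|: U) z.
  move=> dDU; apply: marginal_agree; rewrite agreeU agree_swap_in //=.
  by apply: agree_trans Uyz; apply: agree_swap_out; rewrite disjoint_sym.
have cswap D : [disjoint D & dom c] -> compat c (swap D y z).
  move=> dD; rewrite (compat_agree _ cy).
  by apply: agree_swap_out; rewrite disjoint_sym.
have dAU : [disjoint A & U] by rewrite /U; set_decide.
have dBU : [disjoint B & U] by rewrite /U; set_decide.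
have dAc : [disjoint A & dom c] by set_decide.
have dBc : [disjoint B & dom c] by set_decide.
have dAB : [disjoint A & B] by set_decide.
have hy := h y cy; have hz := h z cz.
have hA := h _ (cswap A dAc); have hB := h _ (cswap B dBc).
move: hy hz hA hB; rewrite /cond_indep -/U swapD // swapD //.
rewrite !(swapU _ U) 1?disjoint_sym //.
rewrite (swapU A (B :|: U)) ?(swapU B (A :|: U)); try by rewrite /U; set_decide.
rewrite (marginal_agree P Uyz) => hy hz hA hB.
apply: (mulIf (M_neq0 U z)); apply: (mulIf (M_neq0 U z)).
transitivity (M (A :|: B :|: U) y * M U z * (M (A :|: B :|: U) z * M U z)).
  by ring.
rewrite hy hz; transitivity
  (M (A :|: B :|: U) (swap B y z) * M U z * (M (A :|: B :|: U) (swap A y z) * M U z)).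
  by rewrite hA hB; ring.
by ring.
Qed.

End Soundness.

(** * Stages *)

Section Tree.
Variables (p : nat) (d : 'I_p -> nat) (L : finType).
Variable theta : pout d -> pout d -> L.
Hypothesis d_gt0 : forall i, (0 < d i)%N.
Hypothesis T_CStree : CStree theta.
Implicit Types (A B C D E S : {set 'I_p}) (x y z w : outcome d).
Implicit Types (c t u v : pout d) (k : 'I_p).

(** A vertex is represented by any outcome passing through it, so vertices, edges and labels are all
    indexed by a level and an outcome. *)
Definition node (k : nat) z : pout d := restr (prefix k) (full z).

Definition label k z : L := theta (node k z) (node k.+1 z).

Definition equistaged k y z := same_stage theta (node k y) (node k z).

Lemma dom_node n z : dom (node n z) = prefix n.
Proof. exact: dom_restr_full. Qed.

Lemma node_level n z : node n z \in level d n.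
Proof. by rewrite inE dom_node. Qed.

Lemma node_last k z : node k.+1 z k = Some (z k).
Proof. by rewrite !ffunE inE ltnSn. Qed.

Lemma node_eq n y z : (node n y == node n z) = agree (prefix n) y z.
Proof. exact: restr_eq_agree. Qed.

Lemma agree_node n y z : agree (prefix n) y z -> node n y = node n z.
Proof. by rewrite -node_eq => /eqP. Qed.

Lemma levelP n v : v \in level d n -> exists z, v = node n z.
Proof.
rewrite inE => /eqP dv; have [z /eqP vz] := compat_exists d_gt0 v.
by exists z; rewrite /node -dv vz.
Qed.

Lemma prefix_inj m n : (m <= p)%N -> (n <= p)%N ->
  prefix m = prefix n :> {set 'I_p} -> m = n.
Proof.
wlog le_mn : m n / (m <= n)%N => [h mp np e|mp np /setP e].
  by case: (leqP m n) => [|/ltnW] mn; [apply: h | apply/esym/h].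
apply/eqP; rewrite eqn_leq le_mn leqNgt; apply/negP => lt_mn.
by have := e (Ordinal (leq_trans lt_mn np)); rewrite !inE /= lt_mn ltnn.
Qed.

Lemma prefix_le m n : (m <= n)%N -> prefix m \subset (prefix n : {set 'I_p}).
Proof. by move=> mn; apply/subsetP => i; rewrite !inE => /leq_trans; apply. Qed.

Lemma prefixS k : prefix k.+1 = k |: prefix k :> {set 'I_p}.
Proof. by apply/setP => i; rewrite !inE ltnS leq_eqVlt. Qed.

Lemma prefixT : prefix p = setT :> {set 'I_p}.
Proof. by apply/setP => i; rewrite !inE ltn_ord. Qed.

Lemma prefix0 : prefix 0 = set0 :> {set 'I_p}.
Proof. by apply/setP => i; rewrite !inE. Qed.

Lemma restr_node m n z : (m <= n)%N -> restr (prefix m) (node n z) = node m z.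
Proof.
move=> mn; apply/ffunP => i; rewrite !ffunE !inE.
by case: ifP => // im; rewrite (leq_trans im mn).
Qed.

Lemma childrenP k z v :
  reflect (exists2 y, agree (prefix k) y z & v = node k.+1 y)
          (v \in children (node k z)).
Proof.
rewrite inE; apply: (iffP existsP) => [[j /and3P[zj vj /eqP vz]]|[y yz ->]].
  have [y vE] := levelP vj; exists y; last first.
    rewrite vE; congr node; congr S; apply: prefix_inj; rewrite // 1?ltnW //.
    by move: zj; rewrite inE dom_restr_full => /eqP.
  have jk : j = k :> nat.
    apply: prefix_inj; rewrite // 1?ltnW //.
    by move: zj; rewrite inE dom_restr_full => /eqP.
  by rewrite -node_eq -[node k z]vz vE -jk restr_node.
by exists k; rewrite node_level node_level restr_node //= node_eq.
Qed.

Lemma node_nonleaf k z : nonleaf (node k z).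
Proof. by apply/existsP; exists k; rewrite node_level. Qed.

Lemma node_vertex k z : vertex (node k z).
Proof.
by apply/existsP; exists (widen_ord (leqnSn p) k); rewrite /= node_level.
Qed.

Lemma label_edge k z : label k z \in edge_labels theta (node k z).
Proof. by apply/imset_f/childrenP; exists z => //; apply: agree_refl. Qed.

Lemma equistaged_refl k z : equistaged k z z.
Proof. exact: eqxx. Qed.

Lemma equistaged_sym k y z : equistaged k y z = equistaged k z y.
Proof. exact: eq_sym. Qed.

Lemma equistaged_trans k y x z :
  equistaged k x y -> equistaged k y z -> equistaged k x z.
Proof. by rewrite /equistaged /same_stage => /eqP ->. Qed.

Lemma agree_equistaged k y z : agree (prefix k) y z -> equistaged k y z.
Proof. by rewrite /equistaged => /agree_node ->; apply: eqxx. Qed.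

Lemma equistaged_label k y z :
  equistaged k y z -> y k = z k -> label k y = label k z.
Proof.
have [_ _ h _] := T_CStree; move=> yz yzk.
apply: (h k _ _ _ _ yz); rewrite ?node_level //.
- by apply/childrenP; exists y => //; apply: agree_refl.
- by apply/childrenP; exists z => //; apply: agree_refl.
by rewrite !node_last yzk.
Qed.

(** Label sets are equal or disjoint, so one common label makes them equal, and label sets of
    different levels differ. *)
Lemma label_equistaged j k y z : label j y = label k z ->
  [/\ j = k, equistaged k y z & y k = z k].
Proof.
have [[cardE disE] lvlE _ _] := T_CStree => e.
have eE : edge_labels theta (node j y) = edge_labels theta (node k z).
  have [//|] := disE _ _ (node_vertex j y) (node_vertex k z).
  by move/disjointFr/(_ (label_edge j y)); rewrite e label_edge.
have jk : j = k.
  apply: contra_eq eE => jk.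
  by apply: lvlE jk _ _; apply: node_level.
subst j; have yz : equistaged k y z by apply/eqP.
(* [y'] passes through the vertex of [y] but has the [k]-th state of [z], so its edge has the label
   of the edge of [y]. Labels at one vertex are distinct, hence both edges coincide. *)
split=> //; pose y' := swap [set k] y z.
have y'y : agree (prefix k) y' y.
  by apply: agree_swap_out; rewrite disjoint_sym disjoints1 inE ltnn.
have y'z : equistaged k y' z by apply: equistaged_trans (agree_equistaged y'y) yz.
have y'k : y' k = z k by rewrite swapE set11.
have e' := equistaged_label y'z y'k.
have /imset_injP inj := introT eqP (cardE _ (node_vertex k y)).
have : node k.+1 y' = node k.+1 y.
  apply: inj; try by apply/childrenP; [exists y' | exists y; rewrite ?agree_refl].
  - by apply/childrenP; exists y'.
  - by apply/childrenP; exists y; rewrite ?agree_refl.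
  by move: e'; rewrite -e /label (agree_node y'y).
by move/eqP; rewrite node_eq => /agreeP/(_ k); rewrite inE ltnSn y'k => /(_ isT).
Qed.

Lemma stageP k y u : u \in stage theta (node k y) ->
  exists2 w, u = node k w & equistaged k y w.
Proof.
have [_ lvl _ _] := T_CStree; rewrite inE => /andP[/existsP[j uj] yu].
case: (eqVneq k j) => [kj|kj].
  by move: uj yu; rewrite -kj => /levelP[w ->] yw; exists w.
by case/negP: (lvl _ _ _ _ kj (node_level k y) uj).
Qed.

(** By the third CStree condition a stage consists of all vertices compatible with some [c]. Its
    elements agree on [dom c], so [dom c] is contained in the stage context. *)
Lemma stage_context_equistaged k y z :
  agree (stage_context theta k (node k y)) z y -> equistaged k y z.
Proof.
have [_ _ _ h] := T_CStree => zy.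
have [c c_sub stE] := h k _ (node_level k y).
have c_stage x : node k x \in stage theta (node k y) -> compat c x.
  rewrite stE => /imsetP[t _ /ffunP e]; apply/compatP => i ic.
  have := e i; rewrite !ffunE (subsetP c_sub) //.
  by move: ic; rewrite inE; case: (c i) => // a _ [->].
have cy : compat c y by apply: c_stage; rewrite inE node_nonleaf; apply: eqxx.
have sub : dom c \subset stage_context theta k (node k y).
  apply/subsetP => i ic; rewrite inE (subsetP c_sub) //=.
  apply/forall_inP => u ust; have [x ux _] := stageP ust.
  move: ust; rewrite ux => /c_stage.
  by rewrite (compat_agree _ cy) => /agreeP/(_ i ic) xy; rewrite !ffunE xy eqxx.
have : node k z \in stage theta (node k y).
  rewrite stE; apply/imsetP; exists (restr (prefix k :\: dom c) (full z)).
    by rewrite inE dom_restr_full.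
  apply/ffunP => i; rewrite 3!ffunE [in RHS]ffunE inE.
  case: (boolP (i \in dom c)) => [ic|ic]; last first.
    have /eqP -> : c i == None by move: ic; rewrite inE negbK.
    by rewrite in_setD ic inE ffunE.
  have /compatP/(_ i ic) -> := cy; move: (subsetP c_sub i ic); rewrite inE => ->.
  by rewrite (agreeP _ _ _ zy) // (subsetP sub).
by rewrite inE => /andP[].
Qed.

End Tree.

(** * Weights of a balanced CStree *)

Section Weights.
Variables (p : nat) (d : 'I_p -> nat) (L : finType).
Variable theta : pout d -> pout d -> L.
Hypothesis d_gt0 : forall i, (0 < d i)%N.
Hypothesis T_CStree : CStree theta.
Variable R : realType.
Implicit Types (A B C D E S : {set 'I_p}) (x y z w : outcome d).
Implicit Types (c t u v : pout d) (k : 'I_p) (q : L -> R).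

Definition label_point q (i : 'I_#|L|) : R := q (enum_val i).

Definition weight q x : R := \prod_(j : 'I_p) q (label theta j x).

(** The value of t([node n z]) at [q], as a sum over full outcomes. *)
Definition subtree_weight q n z : R :=
  \sum_(y | agree (prefix n) y z) \prod_(j : 'I_p | (n <= j)%N) q (label theta j y).

Lemma meval_label_var q l : (label_var R l).@[label_point q] = q l.
Proof. by rewrite mevalXU /label_point enum_rankK. Qed.

Lemma meval_path_monomial q v x :
  (path_monomial theta R v (full x)).@[label_point q] =
  \prod_(j | j \notin dom v) q (label theta j x).
Proof.
rewrite /path_monomial rmorph_prod; apply: eq_bigr => j _.
by rewrite /= meval_label_var.
Qed.

Lemma meval_t_poly q n z :
  (t_poly theta R (node n z)).@[label_point q] = subtree_weight q n z.
Proof.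
rewrite /t_poly raddf_sum /=.
(* [rest] and [fill] match the leaves below the vertex with the outcomes of the remaining
   coordinates. *)
pose fill (u : pout d) : outcome d := [ffun i => odflt (z i) (merge (node n z) u i)].
pose rest (y : outcome d) := restr (~: prefix n) (full y).
rewrite (reindex_onto rest fill) /=; last first.
  move=> u; rewrite inE => /eqP du; apply/ffunP => i; rewrite !ffunE !inE.
  move/setP/(_ i): du; rewrite dom_node !inE.
  by case: (i < n)%N; case: (u i).
apply: eq_big => [y|y].
  rewrite inE dom_node dom_restr_full eqxx /=; apply/eqP/agreeP => [/ffunP h i|h].
    by rewrite -h !ffunE => ->.
  by apply/ffunP => i; move: (h i); rewrite !ffunE !inE; case: (i < n)%N => //= ->.
case/andP => _ /eqP yE.
have -> : merge (node n z) (rest y) = full y.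
  by apply/ffunP => i; rewrite -[in RHS]yE !ffunE !inE; case: (i < n)%N.
rewrite meval_path_monomial; apply: eq_bigl => j.
by rewrite dom_node inE -leqNgt.
Qed.

Lemma label_prefix (j : 'I_p) y z :
  agree (prefix j.+1) y z -> label theta j y = label theta j z.
Proof.
move=> yz; rewrite /label (agree_node yz) (agree_node (agree_sub _ yz)) //.
exact: prefix_le.
Qed.

(** The labels of the first [n] edges are common to the whole cylinder and factor out. *)
Lemma marginal_prefix q n z : marginal (weight q) (prefix n) z =
  \prod_(j : 'I_p | (j < n)%N) q (label theta j z) * subtree_weight q n z.
Proof.
rewrite /marginal /subtree_weight mulr_sumr; apply: eq_bigr => y yz.
rewrite /weight (bigID (fun j : 'I_p => (j < n)%N)) /=; congr (_ * _).
  apply: eq_bigr => j jn; congr q; apply: label_prefix.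
  by apply: agree_sub yz; apply: prefix_le.
by apply: eq_bigl => j; rewrite -leqNgt.
Qed.

Lemma prod_label_prefix q n y z : agree (prefix n) y z ->
  \prod_(j : 'I_p | (j < n)%N) q (label theta j y) =
  \prod_(j : 'I_p | (j < n)%N) q (label theta j z).
Proof.
move=> yz; apply: eq_bigr => j jn; congr q; apply: label_prefix.
by apply: agree_sub yz; apply: prefix_le.
Qed.

Lemma prod_label_prefixS q k z :
  \prod_(j : 'I_p | (j < k.+1)%N) q (label theta j z) =
  q (label theta k z) * \prod_(j : 'I_p | (j < k)%N) q (label theta j z).
Proof.
rewrite (bigD1 k) //=; congr (_ * _); apply: eq_bigl => j.
by rewrite ltnS (ltn_neqAle j k) andbC.
Qed.

Lemma agree_prefix_swap k y z : agree (prefix k) (swap [set k] y z) y.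
Proof. by apply: agree_swap_out; rewrite disjoint_sym disjoints1 inE ltnn. Qed.

Lemma agree_prefixS k y z :
  agree (prefix k.+1) y z = (y k == z k) && agree (prefix k) y z.
Proof.
rewrite prefixS agreeU; congr (_ && _).
by apply/agreeP/eqP => [->//|e i]; rewrite inE // => /eqP ->.
Qed.

Hypothesis T_balanced : balanced theta R.

(** Balancedness evaluated at [q] handles the subtrees. The labels above them match too: the swaps
    keep the first [k] coordinates and exchange the two labels at level [k]. *)
Lemma balanced_marginal q k y z : equistaged theta k y z ->
  marginal (weight q) (prefix k.+1) y * marginal (weight q) (prefix k.+1) z =
  marginal (weight q) (prefix k.+1) (swap [set k] y z) *
  marginal (weight q) (prefix k.+1) (swap [set k] z y).
Proof.
move=> yz; set y' := swap _ y z; set z' := swap _ z y.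
have y'k : y' k = z k by rewrite swapE set11.
have z'k : z' k = y k by rewrite swapE set11.
have y'y : agree (prefix k) y' y := agree_prefix_swap _ _ _.
have z'z : agree (prefix k) z' z := agree_prefix_swap _ _ _.
have bal : subtree_weight q k.+1 y * subtree_weight q k.+1 z =
           subtree_weight q k.+1 y' * subtree_weight q k.+1 z'.
  rewrite -!meval_t_poly -!mevalM; congr meval.
  apply: (T_balanced (node_level _ _) (node_level _ _) yz).
  - by apply/(childrenP d_gt0); exists y; rewrite ?agree_refl.
  - by apply/(childrenP d_gt0); exists y'.
  - by apply/(childrenP d_gt0); exists z'.
  - by apply/(childrenP d_gt0); exists z; rewrite ?agree_refl.
  - by rewrite !node_last z'k.
  - by rewrite !node_last y'k.
rewrite !marginal_prefix !prod_label_prefixS.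
rewrite (prod_label_prefix _ y'y) (prod_label_prefix _ z'z).
have -> : label theta k y' = label theta k z.
  by apply: equistaged_label => //; apply: equistaged_trans (agree_equistaged _ y'y) yz.
have -> : label theta k z' = label theta k y.
  apply: equistaged_label => //; rewrite equistaged_sym.
  by apply: equistaged_trans yz _; apply: agree_equistaged; rewrite agree_sym.
set a := \prod_(j | _) _; set b := \prod_(j | _) _.
transitivity (q (label theta k y) * a * (q (label theta k z) * b) *
   (subtree_weight q k.+1 y * subtree_weight q k.+1 z)); first by ring.
by rewrite bal; ring.
Qed.

(** Summing [balanced_marginal] over the continuations of a vertex shows that the ratio of the
    marginals on [prefix k.+1] and [prefix k] depends only on the stage and the state, that is, on
    the label. *)
Lemma transition_prob_equistaged q k y z : equistaged theta k y z -> y k = z k ->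
  marginal (weight q) (prefix k.+1) y * marginal (weight q) (prefix k) z =
  marginal (weight q) (prefix k) y * marginal (weight q) (prefix k.+1) z.
Proof.
move=> yz yzk; set M := marginal (weight q).
have N x : \sum_(w | agree (prefix k) w x) M (prefix k.+1) w =
    #|cylinder (prefix k.+1 : {set 'I_p}) y|%:R * M (prefix k) x.
  rewrite sum_marginal (card_cylinder _ x y) (setUidPl (prefix_le p (leqnSn k))).
  by rewrite (setIidPl (prefix_le p (leqnSn k))).
have N_neq0 : #|cylinder (prefix k.+1 : {set 'I_p}) y|%:R != 0 :> R.
  by rewrite gt_eqF ?cylinder_gt0.
apply: (mulfI N_neq0); rewrite [LHS]mulrCA [RHS]mulrA -!N mulr_sumr mulr_suml.
(* Match the outcomes through the vertex of [y] with those through the vertex of [z] having the same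
   later coordinates. *)
rewrite (reindex_onto (fun w => swap (prefix k) w z) (fun w => swap (prefix k) w y)) /=.
  apply: eq_big => [w|w /andP[_ /eqP wE]].
    rewrite agree_swap_in //=; apply/eqP/agreeP => [h i ik|h].
      by rewrite -h swapE ik.
    by apply/ffunP => i; rewrite !swapE; case: ifP => [/h ->|->].
  set w' := swap _ w z.
  have wy : agree (prefix k) w y by rewrite -wE; apply: agree_swap_in.
  have w'z : agree (prefix k) w' z by apply: agree_swap_in.
  have w'k : w' k = w k by rewrite swapE inE ltnn.
  have yw' : equistaged theta k y w'.
    by apply: equistaged_trans yz _; apply: agree_equistaged; rewrite agree_sym.
  rewrite (balanced_marginal q yw'); congr (_ * _); apply: marginal_agree.
    rewrite agree_prefixS swapE set11 w'k eqxx /=.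
    by rewrite (agree_trans (agree_prefix_swap _ _ _)) // agree_sym.
  rewrite agree_prefixS swapE set11 yzk eqxx /=.
  by rewrite (agree_trans (agree_prefix_swap _ _ _)).
move=> w wz; apply/ffunP => i; rewrite !swapE; case: ifP => [ik|->//].
by rewrite (agreeP _ _ _ wz).
Qed.

(** All vertices compatible with the stage context share their transition probabilities; sum the
    cross-multiplied identity over them with the [k]-th state fixed. *)
Lemma stage_statement_holds q : (forall l, 0 < q l) ->
  forall A B S c, stage_statement theta A B S c -> csi_holds (weight q) A B S c.
Proof.
move=> q_gt0 A B S c [k v /(levelP d_gt0)[y ->]] {A B S c} z.
set C := stage_context theta k (node k y).
have Csub : C \subset prefix k by apply/subsetP => i; rewrite inE => /andP[].
have -> : restr C (node k y) = restr C (full y).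
  apply/ffunP => i; rewrite !ffunE; case: ifP => // iC.
  by rewrite (subsetP Csub).
rewrite compat_restr => zy; rewrite dom_restr_full /cond_indep set0U.
have -> : [set k] :|: prefix k :\: C :|: C = prefix k.+1.
  by rewrite -setUA setDUK // prefixS.
rewrite setDUK //.
set M := marginal (weight q).
have N_neq0 : #|cylinder (prefix k.+1 : {set 'I_p}) z|%:R != 0 :> R.
  by rewrite gt_eqF ?cylinder_gt0.
have kC : k \notin prefix k by rewrite inE ltnn.
have e1 := sum_marginal (weight q) (prefix k) (k |: C) z.
have e2 := sum_marginal (weight q) (prefix k.+1) (k |: C) z.
move: e1 e2.
have -> : prefix k :|: (k |: C) = prefix k.+1.
  by rewrite setUCA prefixS (setUidPl Csub).
have -> : (k |: C) :&: prefix k = C.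
  by rewrite setIUl (setIidPl Csub) (disjoint_setI0 _) ?set0U // disjoints1.
have sub1 : k |: C \subset prefix k.+1 by rewrite prefixS setUS.
rewrite (setUidPl sub1) (setIidPl sub1) => e1 e2.
apply: (mulfI N_neq0); rewrite [LHS]mulrCA -e1 [RHS]mulrA -e2 mulr_sumr mulr_suml.
apply: eq_bigr => w; rewrite agreeU => /andP[/agreeP wk wz].
rewrite [RHS]mulrC; apply: transition_prob_equistaged; last by rewrite wk ?set11.
apply: (@equistaged_trans _ _ _ _ _ y); last first.
  by apply: (stage_context_equistaged d_gt0) => //; apply: agree_trans wz zy.
by rewrite equistaged_sym; apply: (stage_context_equistaged d_gt0).
Qed.

End Weights.

(** * Lifting saturated statements *)

Section Lifting.
Variables (p : nat) (d : 'I_p -> nat) (L : finType).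
Variable theta : pout d -> pout d -> L.
Hypothesis d_gt0 : forall i, (0 < d i)%N.
Hypothesis T_CStree : CStree theta.
Variable R : realType.
Hypothesis T_balanced : balanced theta R.
Implicit Types (A B C D E S : {set 'I_p}) (x y z w : outcome d).
Implicit Types (c t u v : pout d) (k : 'I_p) (q : L -> R).

Local Notation J := (J_tree theta).

Lemma weight_gt0 q x : (forall l, 0 < q l) -> 0 < weight theta q x.
Proof. by move=> q_gt0; apply: prodr_gt0. Qed.

Lemma J_tree_holds q A B S c : (forall l, 0 < q l) ->
  J A B S c -> csi_holds (weight theta q) A B S c.
Proof.
move=> q_gt0; apply: csi_closure_sound => [x|]; first exact: weight_gt0.
exact: stage_statement_holds.
Qed.

Lemma mem_edge_labels (j k : 'I_p) w x :
  (label theta j w \in edge_labels theta (node k x)) =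
  (j == k) && equistaged theta k x w.
Proof.
apply/idP/andP => [/imsetP[u /(childrenP d_gt0)[y yx ->]] e|[/eqP-> xw]].
  have e' : label theta j w = label theta k y by rewrite e /label (agree_node yx).
  have [jk wy _] := label_equistaged d_gt0 T_CStree e'; split; first exact/eqP.
  rewrite equistaged_sym; move: wy; rewrite -jk => wy.
  by apply: equistaged_trans wy _; apply: agree_equistaged; rewrite jk.
by move: xw; rewrite /equistaged /same_stage => /eqP ->; apply: label_edge.
Qed.

(** A path can meet the labels of this stage only at level [k], so the weight tests membership in
    the stage. *)
Lemma weight_stage k x w :
  weight theta (fun l => if l \in edge_labels theta (node k x) then 2 else 1) w =
  if equistaged theta k x w then 2 else 1 :> R.
Proof.
rewrite /weight (bigD1 k) //= big1 ?mulr1 => [|j jk].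
  by rewrite mem_edge_labels eqxx.
by rewrite mem_edge_labels (negPf jk).
Qed.

(* Putting weight 2 on the labels of one stage turns the two-point form of the
   statement into an equality of powers of 2. *)
Lemma stage_count_swap k A B c x y z :
  pwdisjoint [:: A; B; dom c] -> A :|: B :|: dom c = prefix k ->
  J A B set0 c -> compat c y -> compat c z ->
  (equistaged theta k x y + equistaged theta k x z =
   equistaged theta k x (swap B y z) + equistaged theta k x (swap A y z))%N.
Proof.
move=> dis ABc JAB cy cz.
pose q l : R := if l \in edge_labels theta (node k x) then 2 else 1.
have q_gt0 l : 0 < q l by rewrite /q; case: ifP.
have dis' : pwdisjoint [:: A; B; set0; dom c].
  by pwdisjoint_decide.
have := csi_holds_swap (fun y => weight_gt0 y q_gt0) dis' (J_tree_holds q_gt0 JAB)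
  cy cz (agree0 _ _).
rewrite set0U ABc.
have ME w : marginal (weight theta q) (prefix k) w =
    #|cylinder (prefix k) y|%:R * (if equistaged theta k x w then 2 else 1).
  rewrite (card_cylinder _ y w) /marginal -sum1_card natr_sum mulr_suml.
  apply: eq_big => // v vw; rewrite /q weight_stage mul1r.
  congr (if _ then _ else _); apply/idP/idP => h; apply: equistaged_trans h _;
    by apply: agree_equistaged; rewrite // agree_sym.
have N_neq0 : #|cylinder (prefix k) y|%:R != 0 :> R.
  by rewrite gt_eqF ?cylinder_gt0.
rewrite !ME !mulrA => /eqP; rewrite -!mulrA !(inj_eq (mulfI N_neq0)).
rewrite 2![_ * (#|_|%:R * _)]mulrCA !(inj_eq (mulfI N_neq0)) => /eqP.
by do 4 case: equistaged; move=> //= e; exfalso; move: e; lra.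
Qed.

(** In the context, view the stage as a function e(a,b) of the two parts. Counting says that e(a,b),
    e(a',b') and e(a,b'), e(a',b) are equal as multisets. If e depends on b for some fixed a, it
    cannot depend on a. *)
Lemma stage_split k A B c :
  pwdisjoint [:: A; B; dom c] -> A :|: B :|: dom c = prefix k ->
  J A B set0 c ->
  (forall y z, compat c y -> compat c z -> agree A y z -> equistaged theta k y z) \/
  (forall y z, compat c y -> compat c z -> agree B y z -> equistaged theta k y z).
Proof.
move=> dis ABc JAB.
have [hA|] := boolP [forall y, forall z,
  [&& compat c y, compat c z & agree A y z] ==> equistaged theta k y z].
  left=> y z cy cz yz; have /forallP/(_ y)/forallP/(_ z) := hA.
  by rewrite cy cz yz.
rewrite negb_forall => /existsP[y]; rewrite negb_forall => /existsP[z].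
rewrite negb_imply => /andP[/and3P[cy cz Ayz] yz]; right.
have dAB : [disjoint A & B] by set_decide.
have dAc : [disjoint A & dom c] by set_decide.
have dBc : [disjoint B & dom c] by set_decide.
have agree_k x w : agree A x w -> agree B x w -> agree (dom c) x w ->
    equistaged theta k x w.
  by move=> *; apply: agree_equistaged; rewrite -ABc !agreeU; do !(apply/andP; split).
(* Replacing the [A]-part of any [u] by that of [y] keeps the stage; this gives the second
   alternative. *)
have claim (u : outcome d) : compat c u -> equistaged theta k u (swap B y u).
  move=> cu; set g := swap B y u.
  (* [y] and [z] lie in different stages, so one of them is not in the stage of [g]. *)
  have [h [ch Ahy hg]] : exists h,
      [/\ compat c h, agree A h y & ~~ equistaged theta k h g].
    have [yg|yg] := boolP (equistaged theta k y g); last first.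
      by exists y; rewrite cy agree_refl.
    exists z; rewrite cz agree_sym; split=> //; apply: contra yz => zg.
    by apply: equistaged_trans yg _; rewrite equistaged_sym.
  have sg : equistaged theta k (swap B h u) g.
    apply: agree_k.
    - apply: agree_trans (_ : agree A _ h) _; first exact: agree_swap_out.
      by apply: agree_trans Ahy _; rewrite agree_sym; apply: agree_swap_out.
    - apply: agree_trans (_ : agree B _ u) _; first exact: agree_swap_in.
      by rewrite agree_sym; apply: agree_swap_in.
    apply: agree_trans (_ : agree (dom c) _ h) _.
      by apply: agree_swap_out; rewrite disjoint_sym.
    apply: agree_trans (_ : agree (dom c) _ y) _; first by rewrite -(compat_agree _ cy).
    by rewrite agree_sym; apply: agree_swap_out; rewrite disjoint_sym.
  have sgE x : equistaged theta k x (swap B h u) = equistaged theta k x g.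
    apply/idP/idP => e; apply: equistaged_trans e _ => //.
    by rewrite equistaged_sym.
  apply/negPn/negP => ug.
  (* One swap of [h] and [u] has the stage of [g], which is not that of [h]. Counting the stages of
     [u] and [h] leaves only that of [u]. *)
  have := stage_count_swap u dis ABc JAB ch cu.
  have := stage_count_swap h dis ABc JAB ch cu.
  rewrite !sgE !equistaged_refl (negPf ug) (negPf hg) (equistaged_sym _ _ u h).
  case hu: (equistaged theta k h u) => /=;
    case hs: (equistaged theta k h (swap A h u)) => //= _.
  case us: (equistaged theta k u (swap A h u)) => //= _.
  by move: hu; rewrite (equistaged_trans hs) // equistaged_sym.
move=> u v cu cv uv; apply: equistaged_trans (claim u cu) _.
rewrite equistaged_sym; apply: equistaged_trans (claim v cv) _.
rewrite equistaged_sym; apply: agree_k.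
- apply: agree_trans (_ : agree A _ y) _; first exact: agree_swap_out.
  by rewrite agree_sym; apply: agree_swap_out.
- apply: agree_trans (_ : agree B _ u) _; first exact: agree_swap_in.
  by apply: agree_trans uv _; rewrite agree_sym; apply: agree_swap_in.
apply: agree_trans (_ : agree (dom c) _ y) _.
  by apply: agree_swap_out; rewrite disjoint_sym.
by rewrite agree_sym; apply: agree_swap_out; rewrite disjoint_sym.
Qed.

Lemma another_value y (i : 'I_p) : (1 < d i)%N -> exists z, z i != y i.
Proof.
move=> di; exists [ffun j => odflt (y j) [pick a | a != y j]]; rewrite ffunE.
case: pickP => [a //|none]; have /card_gt1P[a [b [_ _ ab]]] : (1 < #|'I_(d i)|)%N.
  by rewrite card_ord.
move: (none a) (none b) ab => /negbFE/eqP -> /negbFE/eqP ->.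
by rewrite eqxx.
Qed.

(** For each value of [A] the stage statement of a vertex implies the claim in the context extended
    by that value; absorption collects these instances. *)
Lemma stage_statement_split k A B c :
  pwdisjoint [:: A; B; dom c] -> A :|: B :|: dom c = prefix k ->
  (forall i, i \in B -> (1 < d i)%N) ->
  (forall y z, compat c y -> compat c z -> agree A y z -> equistaged theta k y z) ->
  J [set k] B A c.
Proof.
move=> dis ABc dB stA.
have dAB : [disjoint A & B] by set_decide.
have dBc : [disjoint B & dom c] by set_decide.
have dkp : [disjoint [set k] & prefix k] by rewrite disjoints1 inE ltnn.
rewrite -(set0U A); apply: csi_absorption; first by pwdisjoint_decide.
move=> t; rewrite inE => /eqP dt.
have dis_t : [disjoint dom t & dom c] by rewrite dt; set_decide.
have [y cty] := compat_exists d_gt0 (merge t c).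
have [ty cy] : compat t y /\ compat c y.
  by apply/andP; rewrite -compat_merge.
(* [C] is the stage context. It avoids [B], because moving one coordinate in [B] to a second state
   stays in the stage. *)
have [C [JC Cpre CB]] : exists C,
    [/\ J [set k] (prefix k :\: C) set0 (restr C (full y)),
    C \subset prefix k & [disjoint C & B]].
  exists (stage_context theta k (node k y)).
  have Cpre : stage_context theta k (node k y) \subset prefix k.
    by apply/subsetP => i; rewrite inE => /andP[].
  split=> //.
    have -> : restr (stage_context theta k (node k y)) (full y) =
        restr (stage_context theta k (node k y)) (node k y).
      apply/ffunP => i; rewrite !ffunE; case: ifP => // iC.
      by rewrite (subsetP Cpre).
    by apply: csi_base; constructor; apply: node_level.
  rewrite disjoint_sym disjoints_subset; apply/subsetP => i iB; rewrite inE; apply/negP.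
  rewrite inE => /andP[ik /forall_inP h].
  have [z zi] := another_value y (dB i iB).
  have := h (node k (swap [set i] y z)).
  rewrite inE node_nonleaf -/(equistaged theta k y (swap [set i] y z)) stA //.
  - by rewrite !ffunE ik set11 => /(_ isT)/eqP[] /eqP; apply/negP.
  - rewrite (compat_agree _ cy); apply: agree_swap_out.
    by rewrite disjoint_sym disjoints1 (disjointFr dBc iB).
  rewrite agree_sym; apply: agree_swap_out.
  by rewrite disjoint_sym disjoints1 (disjointFl dAB iB).
(* Weak union moves [D] into the conditioning set and specialization fixes it at the values of [y];
   together with [C] this gives the context [merge t c]. *)
set D := (A :|: dom c) :\: C.
have prefixE : prefix k :\: C = B :|: D by rewrite /D; set_decide.
move: JC; rewrite prefixE => JC.
have dom_rD : dom (restr D (full y)) = D by rewrite dom_restr_full.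
have disC : pwdisjoint [:: [set k]; B; D; set0; dom (restr C (full y))].
  by rewrite dom_restr_full /D; clear -dis ABc dkp Cpre CB; pwdisjoint_decide.
have JD := csi_weak_union disC JC.
have disS : pwdisjoint [:: [set k]; B; set0 :|: D; dom (restr C (full y))].
  by rewrite dom_restr_full /D; clear -dis ABc dkp Cpre CB; pwdisjoint_decide.
have JS := @csi_specialization _ _ _ _ _ _ _ (restr D (full y)) disS _ JD.
rewrite dom_rD set0U setDv in JS.
have -> : merge t c = merge (restr D (full y)) (restr C (full y)).
  rewrite -(eqP cty) dom_merge dt; apply/ffunP => i; rewrite !ffunE /D.
  rewrite !inE.
  case iC: (i \in C) => /=.
    move: (subsetP Cpre i iC); rewrite -ABc 2!in_setU.
    by rewrite (disjointFr CB iC) orbF inE => ->.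
  by case: ifP => //; rewrite !ffunE.
by apply: JS.
Qed.

(* Variables with a single state are kept in the context: they belong to every
   stage context, so no stage statement mentions them on its right-hand side. *)
Definition splits_prefix n A B c :=
  [/\ pwdisjoint [:: A; B; dom c], A :|: B :|: dom c = prefix n,
      forall i, i \in A :|: B -> (1 < d i)%N & J A B set0 c].

(** The last clause says that enlarging the context excludes no outcome, as is the case when only
    single-state variables are added. *)
Definition refines A B c A1 B1 c1 :=
  [/\ A \subset A1, B \subset B1, dom c \subset dom c1
    & forall y, compat c y -> compat c1 y].

Lemma splits_prefix_sym n A B c : splits_prefix n A B c -> splits_prefix n B A c.
Proof.
case=> dis ABc AB_gt1 JAB; split; first by pwdisjoint_decide.
- by rewrite (setUC B).
- by rewrite setUC.
by apply: csi_symmetry JAB; pwdisjoint_decide.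
Qed.

(** If the stage depends on [A] only, then [B] is independent of [k] given [A], and contraction with
    the given statement adds [k] to [A]. *)
Lemma splits_prefix_stepl k A B c : splits_prefix k A B c ->
  (forall y z, compat c y -> compat c z -> agree A y z -> equistaged theta k y z) ->
  exists A1 c1, splits_prefix k.+1 A1 B c1 /\ refines A B c A1 B c1.
Proof.
case=> dis ABc AB_gt1 JAB stA.
have dkp : [disjoint [set k] & prefix k] by rewrite disjoints1 inE ltnn.
have B_gt1 i : i \in B -> (1 < d i)%N by move=> iB; apply: AB_gt1; rewrite inE iB orbT.
have JkB := stage_statement_split dis ABc B_gt1 stA.
have JBk : J B [set k] (set0 :|: A) c.
  by rewrite set0U; apply: csi_symmetry JkB; pwdisjoint_decide.
have JBA : J B A set0 c by apply: csi_symmetry JAB; pwdisjoint_decide.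
have JBkA : J B ([set k] :|: A) set0 c.
  by apply: csi_contraction JBk JBA; pwdisjoint_decide.
case: (ltnP 1 (d k)) => dk.
  exists (k |: A), c; split; split; rewrite ?subxx ?subsetUr //.
  - by pwdisjoint_decide.
  - by rewrite -!setUA prefixS -ABc -setUA.
  - by move=> i; rewrite -setUA in_setU1 => /orP[/eqP -> //|/AB_gt1].
  by apply: csi_symmetry JBkA; pwdisjoint_decide.
(* A single-state variable goes into the context: weak union conditions on it and specialization
   fixes its only value. *)
have [y0 _] := compat_exists d_gt0 c.
pose t := restr [set k] (full y0).
have dt : dom t = [set k] by rewrite dom_restr_full.
have dis_t : [disjoint dom t & dom c] by rewrite dt; clear dt; set_decide.
exists A, (merge t c); split; split; rewrite ?subxx //.
- by rewrite dom_merge dt; clear dis_t dt; pwdisjoint_decide.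
- by rewrite dom_merge dt prefixS -ABc setUCA.
- have JBA' : J B A (set0 :|: [set k]) c.
    apply: (@csi_weak_union _ _ _ B A [set k] set0); last by rewrite setUC.
    by clear dis_t dt; pwdisjoint_decide.
  have := @csi_specialization _ _ _ B A (set0 :|: [set k]) c t _ _ JBA'.
  rewrite dt set0U setDv => JBAt; apply: csi_symmetry; last apply: JBAt => //.
    by rewrite dom_merge dt; clear dis_t dt; pwdisjoint_decide.
  by clear dis_t dt; pwdisjoint_decide.
- by rewrite dom_merge subsetUr.
move=> y cy; rewrite compat_merge // cy andbT compat_restr.
apply/agreeP => i; rewrite inE => /eqP ->; apply: val_inj => /=.
by have := ltn_ord (y k); have := ltn_ord (y0 k); lia.
Qed.

Lemma splits_prefix_step k A B c : splits_prefix k A B c ->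
  exists A1 B1 c1, splits_prefix k.+1 A1 B1 c1 /\ refines A B c A1 B1 c1.
Proof.
move=> sp; have [dis ABc _ JAB] := sp.
have [stA|stB] := stage_split dis ABc JAB.
  by have [A1 [c1 h]] := splits_prefix_stepl sp stA; exists A1, B, c1.
have [B1 [c1 [/splits_prefix_sym sp1 [*]]]] :=
  splits_prefix_stepl (splits_prefix_sym sp) stB.
by exists A, B1, c1.
Qed.

Lemma splits_prefix_lift n A B c : (n <= p)%N -> splits_prefix n A B c ->
  exists A1 B1 c1, splits_prefix p A1 B1 c1 /\ refines A B c A1 B1 c1.
Proof.
(* Induction on the number [p - n] of levels still to be added. *)
move=> np; rewrite -(subKn np); move: (p - n)%N (leq_subr n p) => m.
elim: m A B c => [|m IH] A B c mp.
  by rewrite subn0 => sp; exists A, B, c; do !split=> //.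
have k_lt : (p - m.+1 < p)%N by lia.
move=> /(@splits_prefix_step (Ordinal k_lt)) /= [A1 [B1 [c1 []]]].
rewrite subnSK // => /(IH _ _ _ (ltnW mp)) [A2 [B2 [c2 [sp2 [A12 B12 c12 h12]]]]].
case=> A01 B01 c01 h01; exists A2, B2, c2; split=> //; split.
- exact: subset_trans A12.
- exact: subset_trans B12.
- exact: subset_trans c12.
by move=> y /h01/h12.
Qed.

(* Exchanging the k-th coordinates of two outcomes whose first k coordinates
   lie in the same stage is, after lifting the stage statement, a move of a
   saturated statement. *)
Lemma stage_move k y z : equistaged theta k y z -> y k != z k ->
  exists A B c, [/\ pwdisjoint [:: A; B; set0; dom c], A :|: B :|: dom c = setT,
    J A B set0 c, compat c y /\ compat c z & A :&: prefix k.+1 = [set k]].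
Proof.
move=> yz yzk; pose C := stage_context theta k (node k y).
have Cpre : C \subset prefix k by apply/subsetP => i; rewrite inE => /andP[].
have dk : (1 < d k)%N.
  by move: yzk; rewrite -val_eqE /=; have := ltn_ord (y k); have := ltn_ord (z k); lia.
have node_stage w : equistaged theta k y w -> node k w \in stage theta (node k y).
  by rewrite inE node_nonleaf.
have dkp : [disjoint [set k] & prefix k] by rewrite disjoints1 inE ltnn.
have CE : restr C (full y) = restr C (node k y).
  apply/ffunP => i; rewrite !ffunE; case: ifP => // iC.
  by rewrite (subsetP Cpre).
have sp : splits_prefix k.+1 [set k] (prefix k :\: C) (restr C (full y)).
  split; rewrite ?dom_restr_full.
  - by clear -dkp Cpre; move: C Cpre => C Cpre; pwdisjoint_decide.
  - by rewrite -setUA setDUK // prefixS.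
  (* An index outside the stage context takes two values within the stage. *)
  - move=> i; rewrite in_setU1 => /orP[/eqP -> //|]; rewrite inE => /andP[iC ik].
    move: iC; rewrite inE ik /= negb_forall_in => /exists_inP[u].
    case/(stageP d_gt0 T_CStree) => w -> _; rewrite !ffunE ik => wy.
    have : w i != y i by apply: contra wy => /eqP ->.
    by rewrite -val_eqE /=; have := ltn_ord (w i); have := ltn_ord (y i); lia.
  by rewrite CE; apply: csi_base; constructor; apply: node_level.
have [A [B [c [[dis ABc _ JAB] [kA sB Cc hc]]]]] := splits_prefix_lift (ltn_ord k) sp.
rewrite dom_restr_full in Cc.
exists A, B, c; split=> //.
- by pwdisjoint_decide.
- by rewrite ABc prefixT.
- split; apply: hc; rewrite compat_restr ?agree_refl //.
  apply/agreeP => i iC; move: (iC); rewrite inE => /andP[ik].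
  move=> /forall_inP/(_ _ (node_stage z yz)).
  by rewrite !ffunE ik => /eqP[].
(* [B] and [dom c] cover [prefix k] and are disjoint from [A], so [A] contributes only [k] to the
   first [k.+1] indices. *)
move: C Cpre {CE sp hc} sB Cc => C Cpre sB Cc; rewrite prefixS.
have dBc : [disjoint A & B] by set_decide.
have dAc : [disjoint A & dom c] by set_decide.
clear dis ABc; set_decide.
Qed.

End Lifting.

(** * Connecting monomials *)

Lemma exp2_inj (R : numDomainType) : injective (fun n => 2 ^+ n : R).
Proof.
move=> m n /= e; apply/eqP.
by rewrite eqn_leq -!(ler_eXn2l (_ : 1 < 2 :> R)) ?e ?lexx // ltr1n.
Qed.

Section Connecting.
Variables (p : nat) (d : 'I_p -> nat) (L : finType).
Variable theta : pout d -> pout d -> L.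
Hypothesis d_gt0 : forall i, (0 < d i)%N.
Hypothesis T_CStree : CStree theta.
Variable R : realType.
Hypothesis T_balanced : balanced theta R.
Implicit Types (A B C D E S : {set 'I_p}) (x y z w : outcome d).
Implicit Types (c t u v : pout d) (k : 'I_p) (q : L -> R).

Local Notation J := (J_tree theta).

(** An abstract ideal containing the binomials of the saturated statements with empty conditioning
    set; later it becomes the sum of the ideals [I_Sat]. *)
Variable I : model_ring R d -> Prop.
Hypothesis I0 : I 0.
Hypothesis ID : forall f g, I f -> I g -> I (f + g).
Hypothesis IM : forall f g, I g -> I (f * g).
Hypothesis I_saturated : forall A B c y z,
  pwdisjoint [:: A; B; set0; dom c] -> A :|: B :|: dom c = setT ->
  J A B set0 c -> compat c y -> compat c z ->
  I (p_ R y * p_ R z - p_ R (swap B y z) * p_ R (swap A y z)).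

(** The move of [stage_move] alters later coordinates as well, but among the first [k.+1] it
    exchanges only the [k]-th, up to renaming the outcomes: [y] and [z] agree on [dom c]. *)
Lemma exchange_coordinate k y z : equistaged theta k y z -> y k != z k ->
  exists y1 z1, [/\ I (p_ R y * p_ R z - p_ R y1 * p_ R z1),
    forall q, (forall l, 0 < q l) ->
      weight theta q y * weight theta q z = weight theta q y1 * weight theta q z1,
    agree (prefix k) y1 y /\ y1 k = z k & agree (prefix k) z1 z /\ z1 k = y k].
Proof.
move=> yz yzk.
have [A [B [c [dis ABc JAB [cy cz] Ak]]]] := stage_move d_gt0 T_CStree T_balanced yz yzk.
have kA : k \in A by have : k \in [set k] by [rewrite set11]; rewrite -Ak => /setIP[].
have dAB : [disjoint A & B] by set_decide.
have dAk : [disjoint prefix k & A].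
  rewrite disjoints_subset; apply/subsetP => i ik; rewrite inE; apply/negP => iA.
  have : i \in [set k] by rewrite -Ak inE iA (subsetP (prefix_le p (leqnSn k))).
  by move: ik; rewrite !inE => /[swap] /eqP ->; rewrite ltnn.
exists (swap A y z), (swap B y z); split.
- by rewrite [X in _ - X]mulrC; apply: (I_saturated dis ABc).
- move=> q q_gt0; have := csi_holds_swap (fun x => weight_gt0 theta x q_gt0) dis
    (J_tree_holds d_gt0 T_CStree T_balanced q_gt0 JAB) cy cz (agree0 _ _).
  by rewrite set0U ABc !marginalT => ->; rewrite mulrC.
- by rewrite swapE kA; split=> //; apply: agree_swap_out.
rewrite swapE (disjointFr dAB kA); split=> //.
apply/agreeP => i ik; rewrite swapE; case: ifP => // iB.
have : i \in A :|: B :|: dom c by rewrite ABc inE.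
rewrite 2!in_setU iB orbF (disjointFr dAk ik) /= => ic.
by apply: (agreeP _ _ _ _ i ic); rewrite -(compat_agree _ cz).
Qed.

Section Families.
Variable n : nat.
Implicit Types (f g : 'I_n -> outcome d) (i j m : 'I_n).

(** Indexing the factors lets two monomials of the same degree be compared row by row. *)
Definition monomial f : model_ring R d := \prod_i p_ R (f i).

(** Equal label content of two families, expressed through values at positive points. *)
Definition same_weight f g := forall q, (forall l, 0 < q l) ->
  \prod_i weight theta q (f i) = \prod_i weight theta q (g i).

Lemma prod_update (K : comNzRingType) (F : outcome d -> K) f i j y z : i != j ->
  \prod_m F (if m == i then y else if m == j then z else f m) =
  F y * F z * \prod_(m | (m != i) && (m != j)) F (f m).
Proof.
move=> ij; have ji : j != i by rewrite eq_sym.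
rewrite (bigD1 i) //= eqxx (bigD1 j) //= (negPf ji) eqxx mulrA; congr (_ * _).
by apply: eq_bigr => m /andP[mi mj]; rewrite (negPf mi) (negPf mj).
Qed.

Lemma prod_split2 (K : comNzRingType) (F : outcome d -> K) f i j : i != j ->
  \prod_m F (f m) =
  F (f i) * F (f j) * \prod_(m | (m != i) && (m != j)) F (f m).
Proof.
move=> ij; rewrite -(prod_update _ _ _ _ ij); apply: eq_bigr => m _.
by case: eqP => [->//|_]; case: eqP => [->|].
Qed.

(** Weight 2 on a single label counts the rows that use it. *)
Lemma prod_weight_label f k x :
  \prod_i weight theta (fun l => if l == label theta k x then 2 else 1) (f i) =
  2 ^+ #|[set i | label theta k (f i) == label theta k x]| :> R.
Proof.
rewrite -prodr_const [RHS]big_mkcond; apply: eq_bigr => i _.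
rewrite inE /weight (bigD1 k) //= big1 ?mulr1 // => j jk.
case: eqP => // /(label_equistaged d_gt0 T_CStree)[jk'].
by rewrite jk' eqxx in jk.
Qed.

Lemma same_weight_label f g k x : same_weight f g ->
  #|[set i | label theta k (f i) == label theta k x]| =
  #|[set i | label theta k (g i) == label theta k x]|.
Proof.
move=> /(_ (fun l => if l == label theta k x then 2 else 1)) fg.
apply: (@exp2_inj R); rewrite /= -!prod_weight_label; apply: fg => l.
by case: ifP.
Qed.

(** Induction on the number of rows with a wrong [k]-th coordinate; one exchange corrects row [i]
    and spoils no row. *)
Lemma align_level k f g : same_weight f g ->
  (forall i, agree (prefix k) (f i) (g i)) ->
  exists f1, [/\ I (monomial f - monomial f1), same_weight f1 g
    & forall i, agree (prefix k.+1) (f1 i) (g i)].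
Proof.
have [m] := ubnP #|[set i | f i k != g i k]|.
elim: m f => // m IH f; rewrite ltnS => le_m fg agr.
have [fgk|] := boolP [forall i, f i k == g i k].
  exists f; rewrite subrr; split=> // i.
  by rewrite agree_prefixS agr (forallP fgk).
rewrite negb_forall => /existsP[i fgi].
(* Both families use the label of [g i] equally often, and row [i] uses it in [g] but not in [f];
   hence some row [j] uses it in [f] but not in [g]. *)
have [j fj gj] : exists2 j, label theta k (f j) = label theta k (g i) &
    label theta k (g j) != label theta k (g i).
  pose U := [set m | label theta k (f m) == label theta k (g i)].
  pose W := [set m | label theta k (g m) == label theta k (g i)].
  have UW : #|U| = #|W| by apply: same_weight_label.
  have : ~~ (U \subset W).
    apply/negP => sUW; have : i \in W by rewrite inE.
    have /eqP <- : U == W by rewrite eqEcard sUW UW /=.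
    rewrite inE => /eqP/(label_equistaged d_gt0 T_CStree)[_ _ e].
    by rewrite e eqxx in fgi.
  by case/subsetPn => j; rewrite !inE => /eqP; exists j.
have [_ fjgi fjk] := label_equistaged d_gt0 T_CStree fj.
have fij : equistaged theta k (f i) (f j).
  apply: equistaged_trans (agree_equistaged _ (agr i)) _.
  by rewrite equistaged_sym.
have fijk : f i k != f j k by rewrite fjk.
have ij : i != j by apply: contraNneq fijk => ->.
have [y1 [z1 [Iyz wyz [y1f y1k] [z1f z1k]]]] := exchange_coordinate fij fijk.
pose f1 m := if m == i then y1 else if m == j then z1 else f m.
(* Row [j] was already wrong, so changing it cannot increase the count. *)
have fgj : f j k != g j k.
  apply: contra gj => /eqP e; rewrite -fj; apply/eqP/label_prefix.
  by rewrite agree_prefixS e eqxx agree_sym agr.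
have [|||f2 [If2 wf2 agf2]] := IH f1.
- apply: leq_trans le_m; apply: proper_card; apply/properP; split.
    apply/subsetP => a; rewrite !inE /f1; case: (a =P i) => [-> //|_].
    by case: (a =P j) => [-> //|].
  by exists i; rewrite !inE // /f1 eqxx y1k fjk eqxx.
- move=> q q_gt0; rewrite -(fg q q_gt0) prod_update // (prod_split2 _ _ ij).
  by rewrite wyz.
- move=> a; rewrite /f1; case: eqP => [->|_]; first exact: agree_trans y1f (agr i).
  by case: eqP => [->|_] //; apply: agree_trans z1f (agr j).
exists f2; split=> //.
have -> : monomial f - monomial f2 =
    (monomial f - monomial f1) + (monomial f1 - monomial f2) by ring.
apply: ID => //; rewrite /monomial prod_update // (prod_split2 _ _ ij).
by rewrite -mulrBl mulrC; apply: IM.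
Qed.

Lemma same_weight_congr f g : same_weight f g -> I (monomial f - monomial g).
Proof.
move=> fg.
have align (m : nat) : (m <= p)%N -> exists f1, [/\ I (monomial f - monomial f1),
    same_weight f1 g & forall i, agree (prefix m) (f1 i) (g i)].
  elim: m => [_|k IH kp].
    by exists f; rewrite subrr; split=> // i; rewrite prefix0 agree0.
  have [f1 [If1 wf1 agf1]] := IH (ltnW kp).
  have [f2 [If2 wf2 agf2]] := @align_level (Ordinal kp) f1 g wf1 agf1.
  exists f2; split=> //.
  have -> : monomial f - monomial f2 =
    (monomial f - monomial f1) + (monomial f1 - monomial f2) by ring.
  exact: ID.
have [f1 [If1 _ agf1]] := align p (leqnn p).
suff -> : monomial g = monomial f1 by [].
by apply: eq_bigr => i _; move: (agf1 i); rewrite prefixT agreeT => /eqP ->.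
Qed.

End Families.
End Connecting.

(** * From the quotient to the polynomial ring *)

Section Normalization.
Variables (p : nat) (d : 'I_p -> nat) (L : finType).
Variable theta : pout d -> pout d -> L.
Hypothesis d_gt0 : forall i, (0 < d i)%N.
Hypothesis T_CStree : CStree theta.
Variable R : realType.
Hypothesis T_balanced : balanced theta R.
Implicit Types (A B C D E S : {set 'I_p}) (x y z w : outcome d).
Implicit Types (c t u v : pout d) (k : 'I_p) (q : L -> R).

Local Notation J := (J_tree theta).

(** Any edge with label [l] gives the same ratio, as [transition_label] shows; labels on no edge get
    the value 1. *)
Definition transition q (l : L) : R :=
  if [pick kz : 'I_p * outcome d | label theta kz.1 kz.2 == l] is Some kz then
    marginal (weight theta q) (prefix kz.1.+1) kz.2 /
    marginal (weight theta q) (prefix kz.1) kz.2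
  else 1.

Variable q : L -> R.
Hypothesis q_gt0 : forall l, 0 < q l.

Local Notation M := (marginal (weight theta q)).

Let M_gt0 D z : 0 < M D z.
Proof. by apply: marginal_gt0 => x; apply: weight_gt0. Qed.

Let M_neq0 D z : M D z != 0.
Proof. by rewrite gt_eqF. Qed.

Lemma transition_label k z :
  transition q (label theta k z) = M (prefix k.+1) z / M (prefix k) z.
Proof.
rewrite /transition; case: pickP => [[j y] /= /eqP|/(_ (k, z))]; last by rewrite eqxx.
case/(label_equistaged d_gt0 T_CStree) => -> yz yzk; apply/eqP.
rewrite eqr_div // [X in _ == X]mulrC.
by rewrite transition_prob_equistaged.
Qed.

(** The transition probabilities along a path telescope to the normalized weight. *)
Lemma weight_transition z :
  weight theta (transition q) z = weight theta q z / \sum_y weight theta q y.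
Proof.
have prefix_prod n : (n <= p)%N ->
    \prod_(j : 'I_p | (j < n)%N) transition q (label theta j z) =
    M (prefix n) z / M set0 z.
  elim: n => [_|n IH np]; first by rewrite big_pred0 // prefix0 divff.
  rewrite (prod_label_prefixS _ _ (Ordinal np)) IH ?(ltnW np) // transition_label /=.
  by rewrite mulrA mulfVK.
have := prefix_prod p (leqnn p); rewrite prefixT marginalT.
rewrite /weight (eq_bigl predT) => [->|j]; last by rewrite ltn_ord.
by congr (_ / _); rewrite /marginal; apply: eq_bigl => y; rewrite agree0.
Qed.

Lemma sum_transition v : nonleaf v ->
  \sum_(w in children v) transition q (theta v w) = 1.
Proof.
case/existsP => k /(levelP d_gt0)[z ->].
apply: (mulfI (M_neq0 (prefix k) z)); rewrite mulr1 mulr_sumr.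
rewrite [RHS](_ : _ = \sum_(w in children (node k z))
    \sum_(y | agree (prefix k) y z && (node k.+1 y == w)) weight theta q y); last first.
  by apply: partition_big => y yz; apply/(childrenP d_gt0); exists y.
apply: eq_bigr => w /(childrenP d_gt0)[y yz ->].
rewrite -(agree_node yz) -/(label theta k y) transition_label.
rewrite -(marginal_agree _ yz) mulrCA divff // mulr1.
apply: eq_bigl => x; rewrite node_eq andb_idl // => xy.
by apply: agree_trans yz; apply: agree_sub xy; apply: prefix_le.
Qed.

Lemma theta_relation_transition (g : label_ring L R) :
  ideal_gen (theta_relation (R := R) theta) g ->
  g.@[label_point (transition q)] = 0.
Proof.
case=> n [a [h [relh ->]]]; rewrite raddf_sum /= big1 // => i _.
rewrite mevalM; have [v nv ->] := relh i.
rewrite mevalB meval1 raddf_sum /=.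
under eq_bigr do rewrite meval_label_var.
by rewrite sum_transition // subrr mulr0.
Qed.

End Normalization.

(** * Evaluation of psi at label weights *)

Section Kernel.
Variables (p : nat) (d : 'I_p -> nat) (L : finType).
Variable theta : pout d -> pout d -> L.
Variable R : realType.
Implicit Types (q : L -> R) (m : 'X_{1..#|{: outcome d}|}) (f : model_ring R d).

Definition mnm_weight q m : R := \prod_i weight theta q (enum_val i) ^+ m i.

Lemma psi_liftE f : psi_lift theta f =
  \sum_(m <- msupp f) (f@_m *: \prod_i
    path_monomial theta R (root d) (full (enum_val i)) ^+ m i)%:P * 'X^(mdeg m).
Proof.
rewrite /psi_lift /mmap; apply: eq_bigr => m _.
rewrite -mul_mpolyC polyCM -mulrA; congr (_ * _).
rewrite /mmap1 mdegE -prodrXr rmorph_prod -big_split /=.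
by apply: eq_bigr => i _; rewrite exprMn rmorphXn.
Qed.

Lemma meval_psi_lift q f n : ((psi_lift theta f)`_n).@[label_point q] =
  \sum_(m <- msupp f | mdeg m == n) f@_m * mnm_weight q m.
Proof.
rewrite psi_liftE coef_sum raddf_sum /= [RHS]big_mkcond /=.
apply: eq_bigr => m _; rewrite coefCM coefXn eq_sym.
case: eqP => _; last by rewrite mulr0 meval0.
rewrite mulr1 mevalZ rmorph_prod; congr (_ * _); apply: eq_bigr => i _.
rewrite rmorphXn /= meval_path_monomial; congr (_ ^+ _).
by apply: eq_bigl => j; rewrite !inE ffunE.
Qed.

End Kernel.

(** * Separating label monomials by Kronecker substitution *)

Section KroneckerSubstitution.

Lemma base_digits_inj (B n : nat) (a b : 'I_n -> nat) :
  (forall i, (a i < B)%N) -> (forall i, (b i < B)%N) ->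
  (\sum_(i < n) a i * B ^ i = \sum_(i < n) b i * B ^ i)%N -> a =1 b.
Proof.
elim: n a b => [|n IH] a b aB bB; first by move=> _ [].
rewrite !big_ord_recl /= !expn0 !muln1.
have shift (c : 'I_n.+1 -> nat) :
    (\sum_(i < n) c (lift ord0 i) * B ^ lift ord0 i =
     (\sum_(i < n) c (lift ord0 i) * B ^ i) * B)%N.
  by rewrite big_distrl; apply: eq_bigr => i _; rewrite /= /bump /= add1n expnSr mulnA.
rewrite !shift => e.
have B_gt0 : (0 < B)%N by apply: leq_ltn_trans (aB ord0).
have e0 : a ord0 = b ord0.
  by have := congr1 (modn^~ B) e; rewrite /= !(addnC (_ ord0)) !modnMDl !modn_small.
have eS : (\sum_(i < n) a (lift ord0 i) * B ^ i = \sum_(i < n) b (lift ord0 i) * B ^ i)%N.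
  by apply/eqP; rewrite -(eqn_pmul2r B_gt0); apply/eqP; move: e; rewrite e0 => /addnI.
have := IH (a \o lift ord0) (b \o lift ord0) (fun i => aB _) (fun i => bB _) eS.
by move=> h i; case: (unliftP ord0 i) => [j|] ->; [apply: h | apply: e0].
Qed.

(** Otherwise the first [size g] positive integers would be too many roots. *)
Lemma poly_eq0_on_pos (R : realFieldType) (g : {poly R}) :
  (forall X, 0 < X -> g.[X] = 0) -> g = 0.
Proof.
move=> g0; apply/eqP/negPn/negP => g_neq0.
pose rs := [seq i.+1%:R : R | i <- iota 0 (size g)].
have : (size rs < size g)%N.
  apply: max_poly_roots => //.
    by apply/allP => x /mapP[i _ ->]; apply/rootP/g0; rewrite ltr0Sn.
  rewrite map_inj_uniq ?iota_uniq // => i j /eqP.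
  by rewrite eqr_nat => /eqP[].
by rewrite size_map size_iota ltnn.
Qed.

End KroneckerSubstitution.

Section KernelSums.
Variables (p : nat) (d : 'I_p -> nat) (L : finType).
Variable theta : pout d -> pout d -> L.
Variable R : realType.
Implicit Types (q : L -> R) (m : 'X_{1..#|{: outcome d}|}) (f : model_ring R d).

Definition label_count (x : outcome d) (l : 'I_#|L|) : nat :=
  (\sum_(j : 'I_p) (label theta j x == enum_val l))%N.

Lemma prod_label_count (K : comNzRingType) (F : L -> K) (x : outcome d) :
  \prod_(j : 'I_p) F (label theta j x) = \prod_l F (enum_val l) ^+ label_count x l.
Proof.
under [RHS]eq_bigr do rewrite -prodrXr.
rewrite exchange_big; apply: eq_bigr => j _ /=.
rewrite (bigD1 (enum_rank (label theta j x))) //= enum_rankK eqxx expr1.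
rewrite big1 ?mulr1 // => l lj; case: eqP => // e.
by rewrite e enum_valK eqxx in lj.
Qed.

(** The exponent of the label [l] in the image of the monomial [m]. *)
Definition label_exponent m (l : 'I_#|L|) : nat :=
  (\sum_i m i * label_count (enum_val i) l)%N.

Lemma mnm_weightE q m :
  mnm_weight theta q m = \prod_l q (enum_val l) ^+ label_exponent m l.
Proof.
under [RHS]eq_bigr do rewrite -prodrXr.
rewrite exchange_big; apply: eq_bigr => i _ /=.
rewrite /weight prod_label_count -prodrXl; apply: eq_bigr => l _.
by rewrite -exprM mulnC.
Qed.

Definition exponent_bound f : nat :=
  (\max_(m <- msupp f) \max_l label_exponent m l).+1.

(** The label exponents as digits in a base exceeding all of them: the degree in X after
    substituting a power X^(B^l) for each label. *)
Definition kronecker f m : nat :=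
  (\sum_l label_exponent m l * exponent_bound f ^ l)%N.

Lemma kronecker_inj f m1 m2 q : m1 \in msupp f -> m2 \in msupp f ->
  kronecker f m1 = kronecker f m2 -> mnm_weight theta q m1 = mnm_weight theta q m2.
Proof.
move=> m1f m2f e; rewrite !mnm_weightE; apply: eq_bigr => l _; congr (_ ^+ _).
have bound m : m \in msupp f -> forall l, (label_exponent m l < exponent_bound f)%N.
  move=> mf i; rewrite ltnS; apply: leq_trans (leq_bigmax_seq _ mf isT).
  exact: (leq_bigmax (F := label_exponent m)).
exact: (base_digits_inj (bound _ m1f) (bound _ m2f) e).
Qed.

(** Under that substitution the hypothesis says that [g] vanishes at all positive X; its
    coefficients are the class sums. *)
Lemma kernel_class_sum f n :
  (forall q, (forall l, 0 < q l) ->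
    \sum_(m <- msupp f | mdeg m == n) f@_m * mnm_weight theta q m = 0) ->
  forall K, \sum_(m <- msupp f | (mdeg m == n) && (kronecker f m == K)) f@_m = 0.
Proof.
move=> f0 K; pose g : {poly R} := \sum_(m <- msupp f | mdeg m == n)
  f@_m *: 'X^(kronecker f m).
have g0 : g = 0.
  apply: poly_eq0_on_pos => X X_gt0.
  pose q (l : L) : R := X ^+ (exponent_bound f ^ (enum_rank l)).
  rewrite -(f0 q) => [|l]; last exact: exprn_gt0.
  rewrite horner_sum; apply: eq_bigr => m _; rewrite hornerZ hornerXn; congr (_ * _).
  rewrite mnm_weightE -prodrXr; apply: eq_bigr => l _.
  by rewrite /q enum_valK -exprM mulnC.
have /(congr1 (fun h : {poly R} => h`_K)) := g0.
rewrite coef0 coef_sum => e; rewrite -[RHS]e big_mkcondr; apply: eq_bigr => m _.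
by rewrite coefZ coefXn eq_sym; case: eqP; rewrite ?mulr1 ?mulr0.
Qed.

End KernelSums.

(** * The two inclusions *)

Section Ideals.
Variable K : comNzRingType.
Implicit Types (Z : K -> Prop) (f g : K).

Lemma ideal_gen0 Z : ideal_gen Z 0.
Proof. by exists 0, (fun=> 0), (fun=> 0); rewrite big_ord0; split=> // -[]. Qed.

Lemma ideal_gen_base Z f : Z f -> ideal_gen Z f.
Proof.
by move=> Zf; exists 1, (fun=> 1), (fun=> f); rewrite big_ord1 mul1r.
Qed.

Lemma ideal_genD Z f g : ideal_gen Z f -> ideal_gen Z g -> ideal_gen Z (f + g).
Proof.
case=> n [a [u [Zu ->]]] [m [b [v [Zv ->]]]].
exists (n + m), (fun i => match split i with inl j => a j | inr j => b j end),
  (fun i => match split i with inl j => u j | inr j => v j end); split.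
  by move=> i; case: split.
rewrite big_split_ord; congr (_ + _); apply: eq_bigr => i _.
  by rewrite (unsplitK (inl i)).
by rewrite (unsplitK (inr i)).
Qed.

Lemma ideal_genM Z f g : ideal_gen Z g -> ideal_gen Z (f * g).
Proof.
case=> n [a [u [Zu ->]]]; exists n, (fun i => f * a i), u; split=> //.
by rewrite mulr_sumr; apply: eq_bigr => i _; rewrite mulrA.
Qed.

Variables (T : finType) (CC : {set T}) (Z : T -> K -> Prop).

Lemma ideal_sum_base c f : c \in CC -> Z c f ->
  ideal_sum CC (fun c => ideal_gen (Z c)) f.
Proof.
move=> cCC Zf; exists (fun b => if b == c then f else 0); split=> [b _|].
  by case: eqP => [->|_]; [apply: ideal_gen_base | apply: ideal_gen0].
rewrite (bigD1 c) //= eqxx big1 ?addr0 // => b /andP[_ bc].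
by rewrite (negPf bc).
Qed.

Lemma ideal_sum0 : ideal_sum CC (fun c => ideal_gen (Z c)) 0.
Proof. by exists (fun=> 0); split=> [c _|]; [apply: ideal_gen0 | rewrite big1]. Qed.

Lemma ideal_sumD f g : ideal_sum CC (fun c => ideal_gen (Z c)) f ->
  ideal_sum CC (fun c => ideal_gen (Z c)) g ->
  ideal_sum CC (fun c => ideal_gen (Z c)) (f + g).
Proof.
case=> u [Zu ->] [v [Zv ->]]; exists (fun c => u c + v c); split=> [c cCC|].
  by apply: ideal_genD; [apply: Zu | apply: Zv].
by rewrite big_split.
Qed.

Lemma ideal_sumM f g : ideal_sum CC (fun c => ideal_gen (Z c)) g ->
  ideal_sum CC (fun c => ideal_gen (Z c)) (f * g).
Proof.
case=> u [Zu ->]; exists (fun c => f * u c); split=> [c cCC|].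
  by apply: ideal_genM; apply: Zu.
by rewrite mulr_sumr.
Qed.

End Ideals.

(** * The kernel lies in the ideal *)

Section Toric.
Variables (p : nat) (d : 'I_p -> nat) (L : finType).
Variable theta : pout d -> pout d -> L.
Hypothesis d_gt0 : forall i, (0 < d i)%N.
Hypothesis T_CStree : CStree theta.
Variable R : realType.
Hypothesis T_balanced : balanced theta R.
Implicit Types (A B C D E S : {set 'I_p}) (x y z w : outcome d).
Implicit Types (c t u v : pout d) (k : 'I_p) (q : L -> R).

Local Notation J := (J_tree theta).

Variable I : model_ring R d -> Prop.
Hypothesis I0 : I 0.
Hypothesis ID : forall f g, I f -> I g -> I (f + g).
Hypothesis IM : forall f g, I g -> I (f * g).
Hypothesis I_saturated : forall A B c y z,
  pwdisjoint [:: A; B; set0; dom c] -> A :|: B :|: dom c = setT ->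
  J A B set0 c -> compat c y -> compat c z ->
  I (p_ R y * p_ R z - p_ R (swap B y z) * p_ R (swap A y z)).
Implicit Types (m : 'X_{1..#|{: outcome d}|}).

Lemma prod_m2s (K : comNzRingType) n (m : 'X_{1..n}) (F : 'I_n -> K) :
  \prod_(i <- m2s m) F i = \prod_i F i ^+ m i.
Proof.
rewrite /m2s big_flatten big_map /= big_enum /=; apply: eq_bigr => i _.
by rewrite big_nseq iter_mulr_1.
Qed.

(** Listing the variables with multiplicity turns both monomials into families of the same
    length. *)
Lemma mnm_congr m1 m2 : mdeg m1 = mdeg m2 ->
  (forall q, mnm_weight theta q m1 = mnm_weight theta q m2) ->
  I ('X_[m1] - 'X_[m2]).
Proof.
move=> deg12 w12.
pose t1 := Tuple (introT eqP (size_m2s m1)).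
have sz2 : size (m2s m2) == mdeg m1 by rewrite size_m2s deg12.
pose t2 := Tuple sz2.
have F1 (K : comNzRingType) (F : 'I_#|{: outcome d}| -> K) :
    \prod_i F (tnth t1 i) = \prod_i F i ^+ m1 i.
  by rewrite -prod_m2s -(big_tuple _ _ t1 predT).
have F2 (K : comNzRingType) (F : 'I_#|{: outcome d}| -> K) :
    \prod_i F (tnth t2 i) = \prod_i F i ^+ m2 i.
  by rewrite -prod_m2s -(big_tuple _ _ t2 predT).
have XE m : 'X_[m] = \prod_i (p_ R (enum_val i)) ^+ m i.
  by rewrite mpolyXE_id; apply: eq_bigr => i _; rewrite /p_ enum_valK.
rewrite !XE -F1 -F2.
apply: (same_weight_congr d_gt0 T_CStree T_balanced I0 ID IM I_saturated
  (f := fun i => enum_val (tnth t1 i)) (g := fun i => enum_val (tnth t2 i))).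
move=> q _; rewrite (F1 _ (fun i => weight theta q (enum_val i))).
by rewrite (F2 _ (fun i => weight theta q (enum_val i))); apply: w12.
Qed.

Lemma I_sum (T : eqType) (r : seq T) (P : pred T) (F : T -> model_ring R d) :
  (forall i, i \in r -> P i -> I (F i)) -> I (\sum_(i <- r | P i) F i).
Proof.
move=> IF; rewrite big_seq_cond; apply: (big_ind I I0 ID) => i /andP[].
exact: IF.
Qed.

Lemma IZ a f : I f -> I (a *: f).
Proof. by rewrite -mul_mpolyC; apply: IM. Qed.

Lemma ker_psi_sub f : ker_psi theta f -> I f.
Proof.
move=> kf; pose key m := (mdeg m, kronecker theta f m).
have class0 K : \sum_(m <- msupp f | key m == K) f@_m = 0.
  case: K => n K; rewrite -[RHS](kernel_class_sum (theta := theta) (f := f) (n := n) _ K).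
    by apply: eq_bigl => m; rewrite xpair_eqE.
  move=> q q_gt0.
  (* The coefficient of z^n vanishes at the transition probabilities. Its value there is the value
     at [q] times [Z ^- n], a factor common to all monomials of degree [n]. *)
  have := theta_relation_transition d_gt0 T_CStree T_balanced q_gt0 (kf n).
  rewrite meval_psi_lift; set Z := \sum_y weight theta q y => e.
  have Z_neq0 : Z != 0.
    have [y0 _] := compat_exists d_gt0 (root d).
    rewrite gt_eqF // /Z (bigD1 y0) //=; apply: ltr_wpDr; last exact: weight_gt0.
    by apply: sumr_ge0 => y _; apply: ltW; apply: weight_gt0.
  have : Z ^- n != 0 by rewrite invr_eq0 expf_neq0.
  move=> Zn; apply: (mulIf Zn); rewrite mul0r -[RHS]e mulr_suml.
  apply: eq_bigr => m /eqP <-; rewrite -mulrA; congr (_ * _).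
  rewrite /mnm_weight mdegE -exprVn -prodrXr -big_split /=; apply: eq_bigr => i _.
  by rewrite weight_transition // -/Z exprMn.
rewrite [f]mpolyE.
have -> : \sum_(m <- msupp f) f@_m *: 'X_[m] =
    \sum_(K <- undup (map key (msupp f)))
      \sum_(m <- msupp f | key m == K) f@_m *: 'X_[m].
  rewrite (exchange_big_dep predT) //= big_seq [RHS]big_seq; apply: eq_bigr => m mf.
  rewrite big_mkcond (bigD1_seq (key m)) ?undup_uniq ?mem_undup ?map_f //= eqxx.
  by rewrite big1 ?addr0 // => K; rewrite eq_sym => /negPf ->.
apply: I_sum => K; rewrite mem_undup => /mapP[m0 m0f ->] _.
(* The coefficients of a class sum to 0, so its representative can be subtracted from every
   monomial. *)
have -> : \sum_(m <- msupp f | key m == key m0) f@_m *: 'X_[m] =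
    \sum_(m <- msupp f | key m == key m0) f@_m *: ('X_[m] - 'X_[m0]).
  under [RHS]eq_bigr do rewrite scalerBr.
  by rewrite sumrB -scaler_suml class0 scale0r subr0.
apply: I_sum => m mf /eqP[deg kro]; apply: IZ; apply: mnm_congr => // q.
exact: kronecker_inj kro.
Qed.

End Toric.

(** [csi_equiv] says nothing about statements with an empty side. For them one swap returns [y] and
    the other [z]. *)
Lemma csi_binomial_trivial (R : realType) (p : nat) (d : 'I_p -> nat)
    (A B S : {set 'I_p}) (c : pout d) (f : model_ring R d) :
  pwdisjoint [:: A; B; S; dom c] -> A :|: B :|: S :|: dom c = setT ->
  (A == set0) || (B == set0) -> csi_binomial A B S c f -> f = 0.
Proof.
move=> dis ABS AB0 [y z /eqP cy /eqP cz /eqP].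
rewrite restr_eq_agree => Syz.
have Scyz : agree (S :|: dom c) y z by rewrite agreeU Syz -(compat_agree _ cz).
have swap0 u v : swap set0 u v = u :> outcome d.
  by apply/ffunP => i; rewrite swapE inE.
have swapC D : ~: D \subset S :|: dom c -> swap D y z = z.
  move=> sD; apply/ffunP => i; rewrite swapE; case: ifPn => // iD.
  by apply: (agreeP _ _ _ Scyz); rewrite (subsetP sD) // inE.
case/orP: AB0 => /eqP e; rewrite e in dis ABS *.
  by rewrite swap0 (swapC B) 1?mulrC ?subrr //; set_decide.
by rewrite swap0 (swapC A) ?subrr //; set_decide.
Qed.

Lemma homogenized_binomial_eq0 (K : comNzRingType) (a b a' b' : K) :
  a * b = a' * b' -> a%:P * 'X * (b%:P * 'X) - a'%:P * 'X * (b'%:P * 'X) = 0.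
Proof. by move=> e; rewrite !(mulrACA _ 'X) -!polyCM e subrr. Qed.

(** * The ideal lies in the kernel *)

Section Binomials.
Variables (p : nat) (d : 'I_p -> nat) (L : finType).
Variable theta : pout d -> pout d -> L.
Hypothesis d_gt0 : forall i, (0 < d i)%N.
Hypothesis T_CStree : CStree theta.
Variable R : realType.
Hypothesis T_balanced : balanced theta R.
Implicit Types (A B C D E S : {set 'I_p}) (x y z w : outcome d).
Implicit Types (c t u v : pout d) (k : 'I_p) (q : L -> R).

Local Notation J := (J_tree theta).

Lemma path_monomial_root x :
  path_monomial theta R (root d) (full x) =
  \prod_l (label_var R (enum_val l)) ^+ label_count theta x l.
Proof.
rewrite -(prod_label_count theta (label_var R)); apply: eq_bigl => j.
by rewrite !inE ffunE.
Qed.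

Lemma weight_indicator x l :
  weight theta (fun l' => if l' == enum_val l then 2 else 1) x =
  2 ^+ label_count theta x l :> R.
Proof.
rewrite /weight (prod_label_count theta (fun l' => if l' == enum_val l then 2 else 1)).
rewrite (bigD1 l) //= eqxx big1 ?mulr1 // => l' l'l.
by rewrite (inj_eq enum_val_inj) (negPf l'l) expr1n.
Qed.

(** Compare exponents label by label: weight 2 on one label, 1 elsewhere, and the marginal on all
    variables is the weight itself. *)
Lemma path_monomial_swap A B S c y z :
  pwdisjoint [:: A; B; S; dom c] -> A :|: B :|: S :|: dom c = setT ->
  J A B S c -> compat c y -> compat c z -> agree S y z ->
  path_monomial theta R (root d) (full y) * path_monomial theta R (root d) (full z) =
  path_monomial theta R (root d) (full (swap B y z)) *
  path_monomial theta R (root d) (full (swap A y z)).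
Proof.
move=> dis ABS JAB cy cz yz; rewrite !path_monomial_root -!big_split /=.
apply: eq_bigr => l _; rewrite -!exprD; congr (_ ^+ _).
pose q l' : R := if l' == enum_val l then 2 else 1.
have q_gt0 l' : 0 < q l' by rewrite /q; case: ifP.
have := csi_holds_swap (fun x => weight_gt0 theta x q_gt0) dis
    (J_tree_holds d_gt0 T_CStree T_balanced q_gt0 JAB) cy cz yz.
rewrite setUA ABS !marginalT /q !weight_indicator -!exprD => e.
exact: (@exp2_inj R).
Qed.

(** [psi_lift] with its coefficient map written as a composition of ring morphisms, so that morphism
    lemmas apply. *)
Local Notation lift_morphism :=
  (mmap (polyC \o @mpolyC #|L| R)
       (fun i => (path_monomial theta R (root d) (full (enum_val i)))%:P * 'X)).

Lemma psi_lift_ideal (Z : model_ring R d -> Prop) f :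
  (forall g, Z g -> psi_lift theta g = 0) -> ideal_gen Z f -> psi_lift theta f = 0.
Proof.
move=> Z0 [n [a [g [Zg ->]]]].
rewrite -[psi_lift theta _]/(lift_morphism _) rmorph_sum big1 // => i _.
by rewrite rmorphM /= -[mmap _ _ (g i)]/(psi_lift theta _) Z0 ?mulr0.
Qed.

Lemma psi_lift_sum0 (T : finType) (P : {set T}) (g : T -> model_ring R d) :
  (forall a, a \in P -> psi_lift theta (g a) = 0) ->
  psi_lift theta (\sum_(a in P) g a) = 0.
Proof.
by move=> g0; rewrite -[LHS]/(lift_morphism _) rmorph_sum big1.
Qed.

Lemma psi_lift_p_ x : psi_lift theta (p_ R x) =
  (path_monomial theta R (root d) (full x))%:P * 'X.
Proof. by rewrite -[LHS]/(lift_morphism _) mmapX mmap1U enum_rankK. Qed.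

Lemma psi_lift_csi_binomial A B S c (f : model_ring R d) :
  pwdisjoint [:: A; B; S; dom c] -> A :|: B :|: S :|: dom c = setT ->
  (A != set0 -> B != set0 -> J A B S c) -> csi_binomial A B S c f ->
  psi_lift theta f = 0.
Proof.
move=> dis ABS JAB bin; rewrite -[LHS]/(lift_morphism _).
have [A0|A_neq0] := eqVneq A set0.
  by rewrite (csi_binomial_trivial dis ABS _ bin) ?rmorph0 // A0 eqxx.
have [B0|B_neq0] := eqVneq B set0.
  by rewrite (csi_binomial_trivial dis ABS _ bin) ?rmorph0 // B0 eqxx orbT.
case: bin => y z /eqP cy /eqP cz yz.
have Syz : agree S y z by rewrite -restr_eq_agree; apply/eqP.
rewrite rmorphB !rmorphM /= -![mmap _ _ _]/(psi_lift theta _) !psi_lift_p_.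
apply: homogenized_binomial_eq0; apply: (path_monomial_swap dis ABS) => //.
exact: JAB.
Qed.

End Binomials.

(** * Binomials under specialization and absorption *)

Section Saturation.
Variables (R : realType) (p : nat) (d : 'I_p -> nat).
Variables (CC : {set pout d}) (G : pout d -> rel 'I_p).

(** No new binomials arise. A specialized statement has binomials of the original one; after
    absorption, the common [T]-value of the two outcomes selects the instance to use. *)
Lemma sa_closure_binomial A B S c f :
  sa_closure (global_union CC G) A B S c -> A :|: B :|: S :|: dom c = setT ->
  csi_binomial (R := R) A B S c f ->
  ideal_sum CC (fun c => I_Sat (R := R) c (G c)) f.
Proof.
move=> sa; elim: sa f => {A B S c}.
- move=> A B S c [cCC gl] f ABS bin; apply: (ideal_sum_base cCC).
  exists A, B, S; split=> //; case: gl => dis _; clear bin.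
  apply/setP => i; have /setP/(_ i) := ABS; rewrite in_setT in_setU (in_setC i) => h.
  have : [disjoint A :|: B :|: S & dom c] by set_decide.
  by move/(disjoint_in i); move: h; case: (i \in _); case: (i \in _).
- move=> A B S c t dis tS _ IH f ABS [y z cy cz yz]; apply: IH.
    by move: ABS; rewrite dom_merge => <-; set_decide.
  have dtc : [disjoint dom t & dom c] by set_decide.
  move: cy cz => /eqP; rewrite -/(compat _ _) compat_merge // => /andP[ty cy].
  move=> /eqP; rewrite -/(compat _ _) compat_merge // => /andP[tz cz].
  constructor; try exact/eqP.
  apply/eqP; rewrite restr_eq_agree -(setDUK tS) agreeU -restr_eq_agree yz eqxx /=.
  by rewrite -(compat_agree _ tz).
move=> A B S T c dis _ IH f ABS [y z cy cz /eqP].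
rewrite restr_eq_agree agreeU => /andP[Syz Tyz].
have disT : [disjoint T & dom c] by set_decide.
have dt : dom (restr T (full z)) = T by rewrite dom_restr_full.
have dis_t : [disjoint dom (restr T (full z)) & dom c] by rewrite dt.
apply: (IH (restr T (full z))).
- by rewrite inE dt.
- by rewrite dom_merge dt -ABS -!setUA.
have mc x : compat c x -> agree T x z ->
    restr (dom (merge (restr T (full z)) c)) (full x) = merge (restr T (full z)) c.
  by move=> cx xz; apply/eqP; rewrite -/(compat _ _) compat_merge // cx andbT compat_restr.
constructor.
- by apply: mc => //; apply/eqP.
- by apply: mc; rewrite ?agree_refl //; apply/eqP.
by apply/eqP; rewrite restr_eq_agree.
Qed.

End Saturation.

Theorem corollary5p5 (R : realType) (p : nat) (d : 'I_p -> nat)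
    (d_gt0 : forall i, (0 < d i)%N)
    (L : finType) (theta : pout d -> pout d -> L)
    (T_CStree : CStree theta) (T_balanced : balanced theta R)
    (CC : {set pout d}) (G : pout d -> rel 'I_p)
    (G_dag : forall c, c \in CC -> context_dag c (G c))
    (J_global : csi_equiv (J_tree theta) (sa_closure (global_union CC G))) :
  forall f : model_ring R d,
    ker_psi theta f <-> ideal_sum CC (fun c => I_Sat (R := R) c (G c)) f.
Proof.
move=> f; split=> [|[g [gI ->]] n].
  apply: (ker_psi_sub d_gt0 T_CStree T_balanced).
  - exact: ideal_sum0.
  - exact: ideal_sumD.
  - exact: ideal_sumM.
  move=> A B c y z dis ABc JAB cy cz.
  have bin : csi_binomial A B set0 c
      (p_ R y * p_ R z - p_ R (swap B y z) * p_ R (swap A y z)).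
    by constructor; [apply/eqP | apply/eqP | apply/eqP; rewrite restr_eq_agree agree0].
  have cover : A :|: B :|: set0 :|: dom c = setT by rewrite setU0.
  have [|] := boolP ((A == set0) || (B == set0)).
    by move=> /(csi_binomial_trivial dis cover)/(_ bin) ->; apply: ideal_sum0.
  rewrite negb_or => /andP[A_neq0 B_neq0].
  by apply: sa_closure_binomial bin => //; apply/J_global.
(* The generators are killed by the lift itself, before passing to the quotient. *)
suff -> : psi_lift theta (\sum_(c in CC) g c) = 0 by rewrite coef0; apply: ideal_gen0.
apply: psi_lift_sum0 => c cCC.
apply: psi_lift_ideal (gI c cCC) => h [A [B [S [gl ABS bin]]]].
have [dis _] := gl.
apply: (psi_lift_csi_binomial d_gt0 T_CStree T_balanced dis _ _ bin).
  by rewrite ABS setUC setUCr.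
by move=> A_neq0 B_neq0; apply/J_global => //; apply: sa_base.
Qed.
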